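(* Let $\mathcal{O}$ be a complete discrete valuation ring with finite residue field and let $\Lambda=\mathcal{O}[\![T]\!]$. Let $M$ and $N$ be non-trivial finitely generated torsion $\Lambda$-modules. Then $M$ and $N$ are pseudo-isomorphic if and only if $\mathrm{Fitt}_i(M)\sim\mathrm{Fitt}_i(N)$ for all integers $i\geq 0$. In other words, the pseudo-isomorphism class of $M$ is uniquely determined by the classes modulo $\sim$ of the ideals $\mathrm{Fitt}_i(M)$, $i\geq0$.
   Context: For a finitely presented module $M$ over a commutative ring $R$, generated by $n$ elements with presentation $R^k\xrightarrow{\varphi}R^n\to M\to 0$ and $A$ the matrix of $\varphi$, the $i$-th Fitting ideal $\mathrm{Fitt}_i(M)$ is the ideal generated by the $(n-i)$-minors of $A$ if $i\leq n$ (minors of order $0$ equal $1$, and the ideal is $(0)$ if $n-i>k$), and $R$ if $i>n$; it is independent of the presentation. A finitely generated $\Lambda$-module is pseudo-null if it is finite; a pseudo-isomorphism is a $\Lambda$-homomorphism with pseudo-null kernel and cokernel, and two finitely generated torsion $\Lambda$-modules are pseudo-isomorphic if there is a pseudo-isomorphism between them. For ideals $I,J$ of $\Lambda$, $I\prec J$ means that there is an ideal $\mathfrak{a}$ of height $2$ with $\mathfrak{a}I\subset J$, and $I\sim J$ means $I\prec J$ and $J\prec I$. *)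

(* Defs.v *)
From HB Require Import structures.
From mathcomp Require Import all_boot all_order all_algebra.
Set Implicit Arguments. Unset Strict Implicit. Unset Printing Implicit Defensive.
Import GRing.Theory.
Local Open Scope ring_scope.

Definition rdivides (R : comNzRingType) (a b : R) : Prop := exists c : R, b = c * a.

Definition is_uniformizer (O : idomainType) (pi : O) : Prop :=
  pi != 0 /\ pi \isn't a GRing.unit /\
  forall x : O, x != 0 -> exists (u : O) (n : nat), u \is a GRing.unit /\ x = u * pi ^+ n.

Definition pi_adically_complete (O : idomainType) (pi : O) : Prop :=
  forall x : nat -> O,
    (forall k : nat, exists N : nat, forall m n : nat, (N <= m)%N -> (N <= n)%N ->
        rdivides (pi ^+ k) (x m - x n)) ->
    exists l : O, forall k : nat, exists N : nat, forall n : nat, (N <= n)%N ->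
        rdivides (pi ^+ k) (l - x n).

Definition finite_residue_field (O : idomainType) (pi : O) : Prop :=
  exists s : seq O, forall x : O, exists y : O, y \in s /\ rdivides pi (x - y).

Definition complete_dvr_finite_residue (O : idomainType) : Prop :=
  exists pi : O, [/\ is_uniformizer pi, pi_adically_complete pi & finite_residue_field pi].

Definition is_power_series_ring (O : comNzRingType) (L : comNzRingType) (coef : L -> nat -> O) : Prop :=
  [/\ (forall a b : L, coef a =1 coef b -> a = b),
      (forall s : nat -> O, exists a : L, coef a =1 s),
      (forall (a b : L) (n : nat), coef (a + b) n = coef a n + coef b n),
      (forall (a b : L) (n : nat),
          coef (a * b) n = \sum_(i < n.+1) coef a i * coef b (n - i)%N) &
      (forall n : nat, coef 1 n = (n == 0%N)%:R)].

Section Ideals.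
Variable R : comNzRingType.

Definition is_ideal (I : R -> Prop) : Prop :=
  [/\ I 0, (forall x y, I x -> I y -> I (x + y)) & (forall r x, I x -> I (r * x))].

Definition gen_ideal (S : R -> Prop) : R -> Prop :=
  fun x => exists (m : nat) (c s : 'I_m -> R),
      (forall j, S (s j)) /\ x = \sum_(j < m) c j * s j.

Definition ideal_mul (I J : R -> Prop) : R -> Prop :=
  gen_ideal (fun z => exists u v, [/\ I u, J v & z = u * v]).

Definition is_prime_ideal (P : R -> Prop) : Prop :=
  [/\ is_ideal P, ~ P 1 & forall x y, P (x * y) -> P x \/ P y].

Definition prime_chain_to (P : R -> Prop) (n : nat) : Prop :=
  exists Q : nat -> R -> Prop,
    [/\ (forall j, (j <= n)%N -> is_prime_ideal (Q j)),
        (forall j, (j < n)%N -> (forall x, Q j x -> Q j.+1 x) /\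
                                 (exists x, Q j.+1 x /\ ~ Q j x)) &
        (forall x, Q n x <-> P x)].

(* ht(a) = min over primes P containing a of ht(P) = sup lengths of chains ending at P;
   ht(a) = 2 *)
Definition height_two (a : R -> Prop) : Prop :=
  (forall P, is_prime_ideal P -> (forall x, a x -> P x) -> prime_chain_to P 2) /\
  (exists P, [/\ is_prime_ideal P, (forall x, a x -> P x) & ~ prime_chain_to P 3]).

Definition ideal_prec (I J : R -> Prop) : Prop :=
  exists a, [/\ is_ideal a, height_two a & forall x, ideal_mul a I x -> J x].

Definition ideal_sim (I J : R -> Prop) : Prop := ideal_prec I J /\ ideal_prec J I.

End Ideals.

Section Modules.
Variable R : comNzRingType.

Definition fin_gen (M : lmodType R) : Prop :=
  exists (n : nat) (g : 'I_n -> M), forall x : M,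
    exists c : 'I_n -> R, x = \sum_(i < n) c i *: g i.

Definition torsion_mod (M : lmodType R) : Prop :=
  forall x : M, exists r : R, r != 0 /\ r *: x = 0.

Definition nontrivial_mod (M : lmodType R) : Prop := exists x : M, x != 0.

(* R^k --A--> R^n --g--> M --> 0 exact (row-vector convention: the image of the
   l-th basis vector of R^k is the l-th row of A) *)
Definition is_presentation (M : lmodType R) (n k : nat) (g : 'I_n -> M)
    (A : 'M[R]_(k, n)) : Prop :=
  (forall x : M, exists c : 'I_n -> R, x = \sum_(i < n) c i *: g i) /\
  (forall c : 'I_n -> R, \sum_(i < n) c i *: g i = 0 <->
      exists d : 'I_k -> R, forall j, c j = \sum_(l < k) d l * A l j).

Definition minors (k n : nat) (A : 'M[R]_(k, n)) (r : nat) : R -> Prop :=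
  fun x => exists (f : 'I_r -> 'I_k) (h : 'I_r -> 'I_n),
     [/\ injective f, injective h & x = \det (\matrix_(a, b) A (f a) (h b))].

(* Fitt_i(M): ideal generated by the (n-i)-minors of a presentation matrix.
   (Independent of the presentation; for i >= n, (n - i)%N = 0 and the unique
   0-minor is 1, so Fitt_i = R.) *)
Definition fitting_ideal (M : lmodType R) (i : nat) : R -> Prop :=
  fun x => exists (n k : nat) (g : 'I_n -> M) (A : 'M[R]_(k, n)),
     is_presentation g A /\ gen_ideal (minors A (n - i)%N) x.

Definition pseudo_isomorphism (M N : lmodType R) (f : {linear M -> N}) : Prop :=
  (exists s : seq M, forall x : M, f x = 0 -> x \in s) /\
  (exists s : seq N, forall y : N, exists z x, z \in s /\ y = z + f x).

Definition pseudo_isomorphic (M N : lmodType R) : Prop :=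
  exists f : {linear M -> N}, pseudo_isomorphism f.

End Modules.

(* Main.v *)
(* Neither unique factorization nor the structure theorem is needed.  Let pi be a
   uniformizer of O.  By Weierstrass division Lambda[1/pi] is Euclidean, and so is the
   localization of Lambda at (pi).  An ideal of height 2 contains a power of pi and an
   element prime to pi, hence meets both multiplicative sets, so over each of these two
   rings M and N have the same Fitting ideals; by the Smith normal form they become
   isomorphic there, through linear maps f1 and f2 from M to N.  If pi^m D, with D prime
   to pi, kills M and N, then pi^(m+1) f1 + D f2 is an isomorphism over both rings, so its
   kernel and cokernel are killed by a power of pi and by an element prime to pi, hence
   by powers of pi and T, and they are finite.

   Conversely a pseudo-isomorphism has kernel and cokernel killed by pi^e and T^e.  If
   b kills the cokernel of M -> N and N has m generators, then b^m Fitt_i(M) is contained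
   in Fitt_i(N); this also shows (b = 1) that Fitting ideals do not depend on the
   presentation. *)

Require Import Defs.
From HB Require Import structures.
From mathcomp Require Import all_boot all_order all_fingroup all_algebra.
From mathcomp Require Import boolp ring zify.
Set Implicit Arguments. Unset Strict Implicit. Unset Printing Implicit Defensive.
Import GRing.Theory.
Local Open Scope ring_scope.

(** Neither localization is built as a ring. A statement over the localization at [S] is written in
    the base ring with a factor from [S]: divisibility as s a = q b, invertibility of a matrix as a
    determinant in [S], an isomorphism as two maps whose composites are multiplication by one
    element of [S]. For this [S] is closed under divisors. The gluing works because pi^m D = 0 on M
    and N. In the composites of the glued maps the mixed terms carry a multiple of pi^m D and
    vanish, which leaves multiplication by sigma = pi^(2m+2+a) + D^2 s2, where pi^a and s2 come from
    the two local isomorphisms. Multiplying sigma by pi^m or by D removes one summand, so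
    pi^(3m+2+a) and D^3 s2 act as multiples of sigma and kill the kernel and the cokernel. In the
    converse direction a bound for cokernels is enough: a map with kernel and cokernel killed by b
    has a reverse map with composite b^2, whose cokernel is killed by b^2. *)

Section Ideals.
Variable R : comNzRingType.
Implicit Types (I J Q : R -> Prop).

Lemma is_idealB I x y : is_ideal I -> I x -> I y -> I (x - y).
Proof. by move=> [_ ID IM] Ix Iy; rewrite -mulN1r; apply: ID => //; apply: IM. Qed.

Lemma is_ideal_quot I a : is_ideal I -> is_ideal (fun g => I (a * g)).
Proof.
move=> [I0 ID IM]; split; first by rewrite mulr0.
  by move=> x y Ix Iy; rewrite mulrDr; apply: ID.
by move=> r x Ix; rewrite mulrCA; apply: IM.
Qed.

Lemma ideal2_is_ideal (f g : R) : is_ideal (fun y => exists u v, y = u * f + v * g).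
Proof.
split; first by exists 0, 0; rewrite !mul0r addr0.
  by move=> _ _ [u [v ->]] [u' [v' ->]]; exists (u + u'), (v + v'); ring.
by move=> r _ [u [v ->]]; exists (r * u), (r * v); ring.
Qed.

Lemma is_prime_idealX Q x n :
  is_prime_ideal Q -> Q (x ^+ n) -> Q x.
Proof.
move=> [_ Q1 QM]; elim: n => [|n IH]; first by rewrite expr0.
by rewrite exprS => /QM[].
Qed.

Lemma zero_ideal_prime :
  (forall x y : R, x * y = 0 -> x = 0 \/ y = 0) -> is_prime_ideal (fun x : R => x = 0).
Proof.
move=> dom; split=> //; last by move/eqP; rewrite oner_eq0.
split=> // [x y -> ->|r x ->]; first by rewrite addr0.
by rewrite mulr0.
Qed.

Definition fin_gen_ideal I :=
  exists m (s : 'I_m -> R), (forall j, I (s j)) /\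
    forall x, I x -> exists c : 'I_m -> R, x = \sum_j c j * s j.

(** Used with [a] = pi and [J] the quotient ideal (I : pi), where [f] generates [I] modulo pi. *)
Lemma fin_gen_ideal_cons I f J a : is_ideal I -> I f ->
  (forall g, J g -> I (a * g)) -> fin_gen_ideal J ->
  (forall g, I g -> exists h g', J g' /\ g = h * f + a * g') -> fin_gen_ideal I.
Proof.
move=> idI If JI [m [s [Js sgen]]] dec.
exists m.+1, (fun i => if unlift ord0 i is Some j then a * s j else f); split.
  by move=> i; case: unliftP => [j _|_] //; apply/JI/Js.
move=> g /dec[h [g' [/sgen[c ->] ->]]].
exists (fun i => if unlift ord0 i is Some j then c j else h).
rewrite big_ord_recl unlift_none mulr_sumr; congr (_ + _).
by apply: eq_bigr => j _; rewrite liftK mulrCA.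
Qed.

Definition noetherian := forall I : R -> Prop, is_ideal I -> fin_gen_ideal I.

(** The quotient of (x, t) by (x y, t) is an image of R/(y, t); hence representatives of the form r
    + x r'. *)
Lemma finite_quotient_step (x y t : R) :
  (exists s : seq R, forall c, exists r a b, r \in s /\ c = r + x * a + t * b) ->
  (exists s : seq R, forall c, exists r a b, r \in s /\ c = r + y * a + t * b) ->
  exists s : seq R, forall c, exists r a b, r \in s /\ c = r + x * y * a + t * b.
Proof.
move=> [s sE] [s' sE']; exists [seq r + x * r' | r <- s, r' <- s'] => c.
have [r [a [b [rs cE]]]] := sE c; have [r' [a' [b' [rs' aE]]]] := sE' a.
exists (r + x * r'), a', (x * b' + b); split; last by rewrite cE aE; ring.
exact: allpairs_f.
Qed.

Lemma finite_quotient_exp (x t : R) n :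
  (exists s : seq R, forall c, exists r a b, r \in s /\ c = r + x * a + t * b) ->
  exists s : seq R, forall c, exists r a b, r \in s /\ c = r + x ^+ n * a + t * b.
Proof.
move=> fx; elim: n => [|n IH].
  by exists [:: 0] => c; exists 0, c, 0; rewrite inE eqxx expr0; split=> //; ring.
by rewrite exprS; apply: finite_quotient_step.
Qed.

End Ideals.

(** * Minors and Fitting ideals *)

Section MinorIdeals.
Variable R : comNzRingType.
Implicit Types (S I J : R -> Prop).

Lemma gen_ideal_is_ideal S : is_ideal (gen_ideal S).
Proof.
split=> [|x y [m [c [s [Ss ->]]]] [m' [c' [s' [Ss' ->]]]]|r x [m [c [s [Ss ->]]]]].
- exists 0%N, (fun _ => 0), (fun _ => 0); split=> [[]//|].
  by rewrite big_ord0.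
- pose u T (f : 'I_m -> T) (g : 'I_m' -> T) (i : 'I_(m + m')) :=
    match split i with inl j => f j | inr j => g j end.
  have ul T (f : 'I_m -> T) g j : u T f g (lshift _ j) = f j.
    by rewrite /u (unsplitK (inl j)).
  have ur T (f : 'I_m -> T) g j : u T f g (rshift _ j) = g j.
    by rewrite /u (unsplitK (inr j)).
  exists (m + m')%N, (u _ c c'), (u _ s s'); split.
    by move=> j; rewrite /u; case: (split j).
  rewrite big_split_ord /=; congr (_ + _); apply: eq_bigr => j _.
    by rewrite !ul.
  by rewrite !ur.
- exists m, (fun j => r * c j), s; split=> //.
  by rewrite mulr_sumr; apply: eq_bigr => j _; rewrite mulrA.
Qed.

Lemma gen_ideal_sub S x : S x -> gen_ideal S x.
Proof.
move=> Sx; exists 1%N, (fun _ => 1), (fun _ => x); split=> //.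
by rewrite big_ord1 mul1r.
Qed.

Lemma is_ideal_sum I (T : finType) (F : T -> R) :
  is_ideal I -> (forall i, I (F i)) -> I (\sum_i F i).
Proof.
by move=> [I0 ID _] IF; apply: big_ind => // i _; apply: IF.
Qed.

Lemma gen_ideal_min S I :
  is_ideal I -> (forall x, S x -> I x) -> forall x, gen_ideal S x -> I x.
Proof.
move=> idI SI x [m [c [s [Ss ->]]]]; apply: is_ideal_sum => // i.
by case: idI => _ _ IM; apply/IM/SI.
Qed.

Definition minor_ideal k n (A : 'M[R]_(k, n)) r : R -> Prop :=
  gen_ideal (minors A r).

Lemma minor_ideal_is_ideal k n (A : 'M[R]_(k, n)) r : is_ideal (minor_ideal A r).
Proof. exact: gen_ideal_is_ideal. Qed.

(** A repeated row or column gives determinant 0, so the index maps may fail to be injective here,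
    unlike in [minors]. *)
Lemma minor_ideal_mxsub k n (A : 'M[R]_(k, n)) r (f : 'I_r -> 'I_k) (h : 'I_r -> 'I_n) :
  minor_ideal A r (\det (mxsub f h A)).
Proof.
have [I0 _ _] := minor_ideal_is_ideal A r.
case: (boolP (injectiveb f)) => [/injectiveP fi|/injectivePn[i1 [i2 ne e]]].
  case: (boolP (injectiveb h)) => [/injectiveP hi|/injectivePn[i1 [i2 ne e]]].
    by apply: gen_ideal_sub; exists f, h; split.
  rewrite -det_tr (determinant_alternate ne) // => j.
  by rewrite !mxE e.
by rewrite (determinant_alternate ne) // => j; rewrite !mxE e.
Qed.

Lemma minor_ideal0 k n (A : 'M[R]_(k, n)) x : minor_ideal A 0 x.
Proof.
have [_ _ IM] := minor_ideal_is_ideal A 0.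
rewrite -[x]mulr1 -(det_mx00 (mxsub (widen_ord (leq0n k)) (widen_ord (leq0n n)) A)).
exact/IM/minor_ideal_mxsub.
Qed.

Lemma minor_ideal_tr k n (A : 'M[R]_(k, n)) r x :
  minor_ideal A^T r x -> minor_ideal A r x.
Proof.
apply: gen_ideal_min; first exact: minor_ideal_is_ideal.
move=> y [f [h [_ _ ->]]].
rewrite -det_tr; have -> : (\matrix_(a, b) A^T (f a) (h b))^T = mxsub h f A.
  by apply/matrixP => i j; rewrite !mxE.
exact: minor_ideal_mxsub.
Qed.

(** Multilinearity in the rows: the Cauchy-Binet formula before its terms are grouped, which is all
    that ideal membership asks for. *)
Lemma det_mulmx_expand m n (A : 'M[R]_(n, m)) (B : 'M[R]_(m, n)) :
  \det (A *m B) =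
  \sum_(f : {ffun 'I_n -> 'I_m}) (\prod_i A i (f i)) * \det (rowsub f B).
Proof.
rewrite /determinant.
pose AB (s : 'S_n) i j := A i j * B j (s i).
transitivity (\sum_(f : {ffun 'I_n -> 'I_m}) \sum_(s : 'S_n)
   (-1) ^+ s * \prod_i AB s i (f i)).
  rewrite exchange_big; apply: eq_bigr => /= s _; rewrite -big_distrr /=.
  congr (_ * _); rewrite -(bigA_distr_bigA (AB s)) /=.
  by apply: eq_bigr => x _; rewrite mxE.
apply: eq_bigr => f _; rewrite big_distrr /=; apply: eq_bigr => s _.
rewrite mulrCA big_split //=; congr (_ * (_ * _)).
by apply: eq_bigr => x _; rewrite mxE.
Qed.

Lemma minor_ideal_mull k l n (A : 'M[R]_(k, l)) (B : 'M[R]_(l, n)) r x :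
  minor_ideal (A *m B) r x -> minor_ideal B r x.
Proof.
have idB := minor_ideal_is_ideal B r.
apply: gen_ideal_min => // y [f [h [_ _ ->]]].
have -> : \matrix_(a, b) (A *m B) (f a) (h b) = rowsub f A *m colsub h B.
  by rewrite -mxsub_mul; apply/matrixP => i j; rewrite !mxE.
rewrite det_mulmx_expand; apply: is_ideal_sum => // p.
have [_ _ IM] := idB; apply: IM.
have -> : rowsub p (colsub h B) = mxsub p h B by apply/matrixP => i j; rewrite !mxE.
exact: minor_ideal_mxsub.
Qed.

Lemma minor_ideal_mulr k l n (A : 'M[R]_(k, l)) (B : 'M[R]_(l, n)) r x :
  minor_ideal (A *m B) r x -> minor_ideal A r x.
Proof.
move=> ABx; apply/minor_ideal_tr/(@minor_ideal_mull _ _ _ B^T).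
by rewrite -trmx_mul; apply/minor_ideal_tr; rewrite trmxK.
Qed.

(* Laplace expansion along the [bad] columns leaves minors of [V]. *)
Lemma det_mem_minor_ideal l m (V : 'M[R]_(l, m)) s N (Z : 'M[R]_N)
    (bad : pred 'I_N) (rho : 'I_N -> 'I_l) :
  (forall j, ~~ bad j -> exists c, forall a, Z a j = V (rho a) c) ->
  (s + #|bad| <= N)%N -> minor_ideal V s (\det Z).
Proof.
elim: N Z bad rho => [|N IH] Z bad rho good le.
  have -> : s = 0%N by lia.
  exact: minor_ideal0.
have idV := minor_ideal_is_ideal V s.
have [_ _ IM] := idV.
case: (pickP bad) => [j0 bj0|nobad]; last first.
  have cb : #|bad| = 0%N by apply: eq_card0.
  have {}good j : exists c, forall a, Z a j = V (rho a) c by apply: good; rewrite nobad.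
  case: (eqVneq s N.+1) => [es|ns].
    have [c Zc] := choice good.
    have -> : Z = mxsub rho c V by apply/matrixP => i j; rewrite !mxE.
    by rewrite es; apply: minor_ideal_mxsub.
  rewrite (expand_det_col _ ord0); apply: is_ideal_sum => // i; apply/IM/IM.
  apply: (IH _ pred0 (rho \o lift i)) => [j _|]; last by rewrite card0; lia.
  by have [c Zc] := good (lift ord0 j); exists c => a; rewrite !mxE Zc.
rewrite (expand_det_col _ j0); apply: is_ideal_sum => // i; apply/IM/IM.
apply: (IH _ [pred j | bad (lift j0 j)] (rho \o lift i)) => [j nb|].
  by have [c Zc] := good (lift j0 j) nb; exists c => a; rewrite !mxE Zc.
rewrite -ltnS; apply: leq_trans le; rewrite -addnS leq_add2l.
rewrite (cardD1 j0 bad) [j0 \in _]bj0 add1n ltnS.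
rewrite -(card_image (@lift_inj _ j0)); apply: subset_leq_card.
apply/fintype.subsetP => x /imageP[y by_ ->]; rewrite !inE.
by rewrite eq_sym neq_lift.
Qed.

(* [F] induces a map coker A -> coker B whose cokernel is killed by [b]. *)
Lemma minor_ideal_transfer k n l m (A : 'M[R]_(k, n)) (B : 'M[R]_(l, m))
    (F : 'M[R]_(n, m)) (G : 'M[R]_(m, n)) C H b i x :
  A *m F = C *m B -> G *m F = b%:M + H *m B ->
  minor_ideal A (n - i) x -> minor_ideal B (m - i) (b ^+ m * x).
Proof.
move=> eAF eGF; have idB := minor_ideal_is_ideal B (m - i).
have [I0 ID IM] := idB.
move: x; apply: gen_ideal_min => [|x [f [h [_ _ ->]]]]; first exact: is_ideal_quot.
case: (leqP m i) => [mi|im].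
  have -> : (m - i = 0)%N by lia.
  exact: minor_ideal0.
set r := (n - i)%N in f h *.
(* Bordering the minor by the [m] rows of [- G] and [b%:M] multiplies it by b^m; the columns [J] are
   those of [h] and all of the last [m]. *)
pose P := block_mx (rowsub f A) 0 (- G) b%:M : 'M[R]_(r + m, n + m).
pose J (j : 'I_(r + m)) : 'I_(n + m) :=
  match split j with inl j => lshift m (h j) | inr j => rshift n j end.
have detP : \det (colsub J P) = b ^+ m * \det (\matrix_(a, b) A (f a) (h b)).
  have -> : colsub J P = block_mx (\matrix_(a, b) A (f a) (h b)) 0 (- colsub h G) b%:M.
    have Jl j : J (lshift m j) = lshift m (h j) by rewrite /J (unsplitK (inl j)).
    have Jr j : J (rshift r j) = rshift n j by rewrite /J (unsplitK (inr j)).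
    apply/matrixP => u v; case: (split_ordP u) => {}u ->; case: (split_ordP v) => {}v ->.
    - by rewrite mxE Jl !block_mxEul !mxE.
    - by rewrite mxE Jr !block_mxEur !mxE.
    - by rewrite mxE Jl !block_mxEdl !mxE.
    - by rewrite mxE Jr !block_mxEdr !mxE.
  by rewrite det_lblock det_scalar mulrC.
(* Undoing a column operation by [F] turns the last [m] columns into [W *m B]; both matrix
   identities enter here. *)
pose W := col_mx (rowsub f C) (- H).
pose P' := row_mx (col_mx (rowsub f A) (- G)) (W *m B).
have eP : P = P' *m block_mx 1%:M (- F) 0 1%:M.
  rewrite mul_row_block mulmx1 mulmx0 addr0 mulmx1.
  rewrite mulmxN !mul_col_mx mulNmx [rowsub f C *m B]mul_rowsub_mx -eAF.
  rewrite [rowsub f A *m F]mul_rowsub_mx mulNmx eGF opp_col_mx add_col_mx addNr opprK addrK.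
  by rewrite /P block_mxEh.
rewrite -detP eP -mulmx_colsub -det_tr trmx_mul det_mulmx_expand.
apply: is_ideal_sum => // p; apply: IM.
have -> : rowsub p P'^T = (colsub p P')^T by apply/matrixP => u v; rewrite !mxE.
rewrite det_tr.
case: (boolP (injectiveb p)) => [/injectiveP pinj|/injectivePn[i1 [i2 ne e]]]; last first.
  by rewrite -det_tr (determinant_alternate ne) // => j; rewrite !mxE e.
apply: (@minor_ideal_mull _ _ _ W).
(* An injective [p] takes each of the first [n] columns at most once, so at least m - i of the r + m
   chosen columns come from [W *m B]. *)
pose bad := [pred j | (p j < n)%N].
apply: (det_mem_minor_ideal (bad := bad) (rho := id)) => [j nb|].
  have {}nb : (n <= p j)%N by rewrite leqNgt.
  case: (splitP (p j)) => [j' e|j' e]; first by have := ltn_ord j'; lia.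
  exists j' => a; rewrite mxE.
  have -> : p j = rshift n j' by apply: val_inj.
  by rewrite row_mxEr.
suff cb : (#|bad| <= n)%N by apply: (leq_trans (leq_add (leqnn _) cb)); rewrite /r; lia.
rewrite -[leqRHS]card_ord -(card_image pinj).
rewrite -(card_image (@lshift_inj n m)).
apply: subset_leq_card; apply/fintype.subsetP => y /imageP[j bj ->].
apply/imageP; exists (Ordinal bj) => //.
exact: val_inj.
Qed.

End MinorIdeals.

(** * Presentations, induced linear maps and Fitting ideals *)

Section Presentations.
Variable R : comNzRingType.
Implicit Types M N : lmodType R.

Definition lincomb M n (g : 'I_n -> M) (c : 'rV[R]_n) : M :=
  \sum_i c 0 i *: g i.

Lemma lincombP M n (g : 'I_n -> M) a c c' :
  lincomb g (a *: c + c') = a *: lincomb g c + lincomb g c'.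
Proof.
rewrite /lincomb scaler_sumr -big_split /=; apply: eq_bigr => i _.
by rewrite !mxE scalerDl scalerA.
Qed.

Lemma lincomb0 M n (g : 'I_n -> M) : lincomb g 0 = 0.
Proof. by rewrite /lincomb big1 // => i _; rewrite mxE scale0r. Qed.

Lemma lincombD M n (g : 'I_n -> M) c c' :
  lincomb g (c + c') = lincomb g c + lincomb g c'.
Proof. by have := lincombP g 1 c c'; rewrite !scale1r. Qed.

Lemma lincombZ M n (g : 'I_n -> M) a c : lincomb g (a *: c) = a *: lincomb g c.
Proof. by rewrite -[a *: c]addr0 lincombP lincomb0 addr0. Qed.

Lemma lincombB M n (g : 'I_n -> M) c c' :
  lincomb g (c - c') = lincomb g c - lincomb g c'.
Proof. by rewrite -[- c']scaleN1r lincombD lincombZ scaleN1r. Qed.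

Lemma lincomb_mul M m n (g : 'I_n -> M) c (F : 'M[R]_(m, n)) :
  lincomb g (c *m F) = lincomb (fun i => lincomb g (row i F)) c.
Proof.
rewrite /lincomb; under [RHS]eq_bigr => i _ do rewrite scaler_sumr.
rewrite exchange_big /=; apply: eq_bigr => j _.
rewrite mxE scaler_suml; apply: eq_bigr => i _.
by rewrite mxE scalerA.
Qed.

Lemma lincomb_delta M n (g : 'I_n -> M) i : lincomb g (delta_mx 0 i) = g i.
Proof.
rewrite /lincomb (bigD1 i) //= big1 => [|j ne]; rewrite mxE eqxx ?eqxx ?scale1r ?addr0 //=.
by rewrite (negbTE ne) scale0r.
Qed.

Lemma linear_lincomb M N (f : {linear M -> N}) n (g : 'I_n -> M) c :
  f (lincomb g c) = lincomb (f \o g) c.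
Proof. by rewrite linear_sum; apply: eq_bigr => i _; rewrite linearZ. Qed.

Lemma presentationP M n k (g : 'I_n -> M) (A : 'M[R]_(k, n)) :
  is_presentation g A <->
  (forall x, exists c, x = lincomb g c) /\
  (forall c, lincomb g c = 0 <-> exists d, c = d *m A).
Proof.
have lE c : \sum_(i < n) c i *: g i = lincomb g (\row_i c i).
  by apply: eq_bigr => i _; rewrite mxE.
split=> -[gen rel]; split.
- by move=> x; have [c ->] := gen x; exists (\row_i c i); rewrite lE.
- move=> c; rewrite /lincomb rel; split=> -[d dE].
    exists (\row_l d l); apply/rowP => j; rewrite dE mxE.
    by apply: eq_bigr => l _; rewrite mxE.
  by exists (d 0) => j; rewrite dE mxE.
- by move=> x; have [c ->] := gen x; exists (c 0).
- move=> c; rewrite lE rel; split=> -[d dE].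
    by exists (d 0) => j; move/rowP: dE => /(_ j); rewrite !mxE.
  exists (\row_l d l); apply/rowP => j; rewrite !mxE dE.
  by apply: eq_bigr => l _; rewrite mxE.
Qed.

Lemma rows_mul m k n (X : 'M[R]_(m, n)) (B : 'M[R]_(k, n)) :
  (forall a, exists d, row a X = d *m B) -> exists C, X = C *m B.
Proof.
case/choice => d dE; exists (\matrix_a d a).
by apply/row_matrixP => a; rewrite row_mul rowK dE.
Qed.

Section TwoPresentations.
Variables (M N : lmodType R) (n k m l : nat).
Variables (g : 'I_n -> M) (A : 'M[R]_(k, n)) (g' : 'I_m -> N) (B : 'M[R]_(l, m)).
Hypotheses (pA : is_presentation g A) (pB : is_presentation g' B).

Lemma relation_row a : lincomb g (row a A) = 0.
Proof.
have [_ relA] := (presentationP g A).1 pA.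
by apply/relA; exists (delta_mx 0 a); rewrite rowE.
Qed.

Lemma linear_of_matrix (F : 'M[R]_(n, m)) C :
  A *m F = C *m B ->
  exists f : {linear M -> N}, forall c, f (lincomb g c) = lincomb g' (c *m F).
Proof.
move=> eAF.
have [[genA relA] [genB relB]] := ((presentationP g A).1 pA, (presentationP g' B).1 pB).
have [r rE] := choice genA.
pose f x := lincomb g' (r x *m F).
have fE c : f (lincomb g c) = lincomb g' (c *m F).
  apply/eqP; rewrite -subr_eq0 -lincombB -mulmxBl; apply/eqP/relB.
  have [d ->] : exists d, r (lincomb g c) - c = d *m A.
    by apply/relA; rewrite lincombB -rE subrr.
  by exists (d *m C); rewrite -!mulmxA eAF.
have lin : linear f.
  move=> a x y; rewrite [x]rE [y]rE -lincombP !fE mulmxDl -scalemxAl.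
  by rewrite lincombP.
pose fl : {linear M -> N} := HB.pack f (GRing.isLinear.Build R M N _ f lin).
by exists fl.
Qed.

Lemma minor_ideal_map (f : {linear M -> N}) b i x :
  (forall y, exists z, b *: y = f z) ->
  minor_ideal A (n - i) x -> minor_ideal B (m - i) (b ^+ m * x).
Proof.
move=> bf.
have [[genA relA] [genB relB]] := ((presentationP g A).1 pA, (presentationP g' B).1 pB).
have /choice[F FE] : forall j, exists c, f (g j) = lincomb g' c by move=> j; apply: genB.
have /choice[G GE] : forall j, exists c, b *: g' j = f (lincomb g c).
  by move=> j; have [z ->] := bf (g' j); have [c ->] := genA z; exists c.
have fE c : f (lincomb g c) = lincomb g' (c *m \matrix_j F j).
  rewrite linear_lincomb lincomb_mul; apply: eq_bigr => j _.
  by rewrite rowK -FE.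
have [C CE] : exists C, A *m \matrix_j F j = C *m B.
  apply: rows_mul => a; apply/relB; rewrite row_mul -fE relation_row.
  by rewrite linear0.
have [H HE] : exists H, \matrix_j G j *m \matrix_j F j - b%:M = H *m B.
  apply: rows_mul => j; apply/relB; rewrite raddfB /= row_mul rowK lincombB -fE -GE.
  by rewrite rowE mul_mx_scalar lincombZ lincomb_delta subrr.
by apply: (minor_ideal_transfer CE (H := H)); rewrite -HE addrC subrK.
Qed.

End TwoPresentations.

Lemma fitting_idealE M n k (g : 'I_n -> M) (A : 'M[R]_(k, n)) i x :
  is_presentation g A -> fitting_ideal M i x <-> minor_ideal A (n - i) x.
Proof.
move=> pA; split=> [[n' [k' [g' [A' [pA' mx]]]]]|mx]; last by exists n, k, g, A.
have := minor_ideal_map pA' pA (f := idfun) (b := 1) _ mx.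
by rewrite expr1n mul1r; apply=> y; exists y; rewrite scale1r.
Qed.

Lemma fitting_ideal_map M N (f : {linear M -> N}) b :
  (exists n k g A, @is_presentation R M n k g A) ->
  (exists n k g A, @is_presentation R N n k g A) ->
  (forall y, exists z, b *: y = f z) ->
  exists m, forall i x, fitting_ideal M i x -> fitting_ideal N i (b ^+ m * x).
Proof.
move=> [n [k [g [A pA]]]] [m [l [g' [B pB]]]] bf; exists m => i x Fx.
apply/(fitting_idealE _ _ pB); apply: (minor_ideal_map pA pB) bf _.
exact/(fitting_idealE _ _ pA).
Qed.

(** A preimage of b y under [f] is unique up to the kernel, and a second factor [b] removes this
    ambiguity; so y is sent to b times any such preimage, and this is linear. *)
Lemma isogeny_inverse M N (f : {linear M -> N}) b :
  (forall y, exists x, b *: y = f x) -> (forall x, f x = 0 -> b *: x = 0) ->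
  exists h : {linear N -> M}, forall x, h (f x) = b ^+ 2 *: x.
Proof.
move=> /choice[r rE] fb.
pose h y := b *: r y.
have hE y x : b *: y = f x -> h y = b *: x.
  move=> e; apply/eqP; rewrite -subr_eq0 -scalerBr; apply/eqP/fb.
  by rewrite linearB /= -rE e subrr.
have lin : linear h.
  move=> a x y; rewrite (hE _ (a *: r x + r y)).
    by rewrite scalerDr scalerA mulrC -scalerA.
  by rewrite linearP /= -!rE scalerDr !scalerA mulrC.
pose hl : {linear N -> M} := HB.pack h (GRing.isLinear.Build R N M _ h lin).
exists hl => x; rewrite /= (hE _ (b *: x)) ?scalerA //.
by rewrite linearZ.
Qed.

(** Induction on [n]: the first coordinates of vectors in [P] form an ideal, and the vectors of [P]
    with first coordinate 0 form a submodule of smaller rank. The rows of [S] lift generators of the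
    ideal. *)
Lemma submodule_fin_gen n (P : 'rV[R]_n -> Prop) :
  noetherian R -> P 0 -> (forall a u v, P u -> P v -> P (a *: u + v)) ->
  exists k (A : 'M[R]_(k, n)), forall v, P v <-> exists d, v = d *m A.
Proof.
move=> noe; elim: n P => [|n IH] P P0 PD.
  exists 0%N, 0 => v; split=> [_|[d ->]]; first by exists 0; rewrite [v]thinmx0 thinmx0.
  by rewrite mulmx0.
move: P P0 PD; rewrite -[n.+1]/(1 + n)%N => P P0 PD.
pose I a := exists v : 'rV_n, P (row_mx (a%:M : 'M_1) v).
have rowE0 : row_mx (0 : 'M_1) (0 : 'rV[R]_n) = 0 by rewrite row_mx0.
have PZ a u : P u -> P (a *: u) by move=> Pu; rewrite -[a *: u]addr0; apply: PD.
have PA u v : P u -> P v -> P (u + v) by move=> Pu Pv; rewrite -[u]scale1r; apply: PD.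
have idI : is_ideal I.
  split=> [|x y [v Pv] [w Pw]|r x [v Pv]].
  - by exists 0; rewrite raddf0 rowE0.
  - by exists (v + w); rewrite raddfD /= -add_row_mx; apply: PA.
  - exists (r *: v); have := PZ r _ Pv.
    by rewrite scale_row_mx scale_scalar_mx.
have [m [s [Is sgen]]] := noe I idI.
have [v Pv] := choice Is.
have [||k [A AE]] := IH (fun w => P (row_mx 0 w)).
- by rewrite rowE0.
- by move=> a x y Px Py; have := PD a _ _ Px Py; rewrite scale_row_mx add_row_mx scaler0 add0r.
have Pcomb (S : 'M_(m, 1 + n)) d : (forall j, P (row j S)) -> P (d *m S).
  move=> PS; rewrite mulmx_sum_row.
  by apply: big_ind => // i _; apply: PZ.
pose S : 'M_(m, 1 + n) := \matrix_j row_mx (s j)%:M (v j).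
have PS j : P (row j S) by rewrite rowK.
exists (m + k)%N, (col_mx S (row_mx 0 A)) => w; split.
  move=> Pw; have [x xw] : exists x, lsubmx (w : 'M_(1, 1 + n)) = x%:M.
    by exists (lsubmx (w : 'M_(1, 1 + n)) 0 0); apply: mx11_scalar.
  have [c cE] : exists c : 'I_m -> R, x = \sum_j c j * s j.
    by apply: sgen; exists (rsubmx (w : 'M_(1, 1 + n))); rewrite -xw hsubmxK.
  pose c' := \row_j c j.
  have lS : lsubmx (c' *m S) = x%:M.
    rewrite [LHS]mx11_scalar !mxE cE; congr _%:M.
    by apply: eq_bigr => j _; rewrite [c' _ _]mxE [S _ _]mxE row_mxEl mxE eqxx mulr1n.
  have [d dE] : exists d, rsubmx (w - c' *m S : 'M_(1, 1 + n)) = d *m A.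
    apply/AE; have <- : lsubmx (w - c' *m S : 'M_(1, 1 + n)) = 0.
      by rewrite linearB /= lS xw subrr.
    by rewrite hsubmxK addrC -scaleN1r; apply: PD => //; apply: Pcomb.
  exists (row_mx c' d); rewrite mul_row_col mul_mx_row mulmx0 -dE.
  have <- : lsubmx (w - c' *m S : 'M_(1, 1 + n)) = 0 by rewrite linearB /= lS xw subrr.
  by rewrite hsubmxK addrC subrK.
move=> [d ->]; rewrite -[d]hsubmxK mul_row_col; apply: PA; first exact: Pcomb.
by rewrite mul_mx_row mulmx0; apply/AE; eexists.
Qed.

(** Padding with zero generators and zero relations leaves [n] and [k] free above a bound, so that
    two modules can be presented by matrices of one common size. *)
Lemma fin_gen_presentation M : noetherian R -> fin_gen M ->
  exists n0, forall n, (n0 <= n)%N -> exists (g : 'I_n -> M) k0,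
  forall k, (k0 <= k)%N -> exists A : 'M[R]_(k, n), is_presentation g A.
Proof.
move=> noe [n0 [g0 gen0]]; exists n0 => n le_n; rewrite -(subnKC le_n).
pose ext T (z : T) (h : 'I_n0 -> T) (i : 'I_(n0 + (n - n0))) :=
  if split i is inl j then h j else z.
pose g := ext M 0 g0.
have gen x : exists c, x = lincomb g c.
  have [c ->] := gen0 x; exists (\row_i ext R 0 c i).
  rewrite /lincomb big_split_ord /= [X in _ = _ + X]big1 ?addr0 => [|j _]; last first.
    by rewrite mxE /ext (unsplitK (inr j)) scale0r.
  by apply: eq_bigr => j _; rewrite mxE /g /ext (unsplitK (inl j)).
exists g.
have [||k0 [A AE]] := @submodule_fin_gen _ (fun c => lincomb g c = 0) noe.
- exact: lincomb0.
- by move=> a u v u0 v0; rewrite lincombP u0 v0 scaler0 addr0.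
exists k0 => k le_k; rewrite -(subnKC le_k); exists (col_mx A 0).
apply/presentationP; split=> // c; rewrite AE; split=> -[d ->].
  by exists (row_mx d 0); rewrite mul_row_col mulmx0 addr0.
by exists (lsubmx d); rewrite -{1}[d]hsubmxK mul_row_col mulmx0 addr0.
Qed.

End Presentations.

(** * Smith normal form up to a multiplicative set *)

Lemma ex_least (P : nat -> Prop) :
  (exists n, P n) -> exists n, P n /\ forall m, P m -> (n <= m)%N.
Proof.
move=> [n Pn]; have ex : exists n, `[< P n >] by exists n; apply/asboolP.
case: (ex_minnP ex) => m /asboolP Pm min; exists m; split=> // p Pp.
exact/min/asboolP.
Qed.

(* The localization of [R] at [S] is Euclidean; [W b d] reads "b has degree d". *)
Record euclidean_up_to (R : comNzRingType) (S : R -> Prop) (W : R -> nat -> Prop) :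
  Prop := EuclideanUpTo {
  euc_domain : forall x y : R, x * y = 0 -> x = 0 \/ y = 0;
  euc_S1 : S 1;
  euc_S0 : ~ S 0;
  euc_SM : forall x y, S x -> S y -> S (x * y);
  euc_Sdiv : forall x y, S (x * y) -> S x;
  euc_W : forall b, b != 0 -> exists d, W b d;
  euc_div : forall a b d, b != 0 -> W b d -> exists s q,
    S s /\ (s * a = q * b \/
      s * a - q * b != 0 /\ exists d', (d' < d)%N /\ W (s * a - q * b) d') }.

Section Euclidean.
Variables (R : comNzRingType) (S : R -> Prop) (W : R -> nat -> Prop).
Hypothesis eucS : euclidean_up_to S W.

Let S1 := euc_S1 eucS.
Let SM := euc_SM eucS.

Lemma euc_mulIf (z x y : R) : z != 0 -> x * z = y * z -> x = y.
Proof.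
move=> nz e; have /(euc_domain eucS)[] : (x - y) * z = 0 by rewrite mulrBl e subrr.
  by move/eqP; rewrite subr_eq0 => /eqP.
by move/eqP; rewrite (negbTE nz).
Qed.

Lemma euc_S_neq0 s : S s -> s != 0.
Proof. by move=> Ss; apply/eqP => s0; apply: (euc_S0 eucS); rewrite -s0. Qed.

Lemma euc_mul_neq0 (x y : R) : x != 0 -> y != 0 -> x * y != 0.
Proof.
by move=> nx ny; apply/eqP => /(euc_domain eucS)[] /eqP; rewrite ?(negbTE nx) ?(negbTE ny).
Qed.

Lemma euc_SX s n : S s -> S (s ^+ n).
Proof. by move=> Ss; elim: n => [|n IH]; rewrite ?expr0 // exprS; apply: SM. Qed.

Lemma euc_SN1 : S (-1).
Proof. by apply: (euc_Sdiv eucS (y := -1)); rewrite mulrNN mulr1. Qed.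

Lemma euc_common (T : finType) (c : T -> R) d :
  (forall i, exists s q, S s /\ s * c i = q * d) ->
  exists s (q : T -> R), S s /\ forall i, s * c i = q i * d.
Proof.
move=> /choice[s /choice[q sq]].
exists (\prod_i s i), (fun i => (\prod_(j | j != i) s j) * q i); split.
  by apply: big_ind => // i _; case: (sq i).
by move=> i; rewrite (bigD1 i) //= mulrAC (sq i).2; ring.
Qed.

(** An element of least degree generates the localized ideal. Its minimality is part of the
    conclusion because [euc_prime_avoiding] compares degrees of generators of different ideals. *)
Lemma euc_principal (I : R -> Prop) : is_ideal I -> (exists x, I x /\ x != 0) ->
  exists h d, [/\ I h, h != 0, W h d,
    forall y d', I y -> y != 0 -> W y d' -> (d <= d')%N &
    forall y, I y -> exists s q, S s /\ s * y = q * h].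
Proof.
move=> [I0 ID IM] [x [Ix nx]].
have [|d [[h [Ih nh Wh]] min]] :=
  @ex_least (fun d => exists h, [/\ I h, h != 0 & W h d]).
  by have [d Wd] := euc_W eucS nx; exists d, x.
have minI y d' : I y -> y != 0 -> W y d' -> (d <= d')%N.
  by move=> Iy ny Wy; apply: min; exists y.
exists h, d; split=> // y Iy.
have [s [q [Ss [e|[ne [d' [lt Wd']]]]]]] := euc_div eucS y nh Wh; first by exists s, q.
suff : (d <= d')%N by lia.
apply: minI Wd' => //; apply: ID; first exact: IM.
by rewrite -mulNr; apply: IM.
Qed.

(** No maximality principle: among the non-units [h] that divide all of [a] over the localization,
    one of least degree is irreducible there, and the prime is the contraction of the ideal that it
    generates. *)
Lemma euc_prime_avoiding (a : R -> Prop) :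
  is_ideal a -> (exists x, a x /\ x != 0) -> (forall x, a x -> ~ S x) ->
  exists P, [/\ is_prime_ideal P, forall x, a x -> P x & forall x, P x -> ~ S x].
Proof.
move=> ida nza avoid.
pose good h := [/\ h != 0, ~ S h & forall y, a y -> exists s q, S s /\ s * y = q * h].
have [|d [[h [[nh nSh hdiv] Wh]] min]] :=
  @ex_least (fun d => exists h, good h /\ W h d).
  have [h [d [ah nh Wh _ hd]]] := euc_principal ida nza.
  by exists d, h; split=> //; split=> //; apply: avoid.
pose P x := exists s q, S s /\ s * x = q * h.
have PS x : P x -> ~ S x.
  move=> [s [q [Ss e]]] Sx; apply: nSh; apply: (euc_Sdiv eucS (y := q)).
  by rewrite mulrC -e; apply: SM.
have idP : is_ideal P.
  split.
  - by exists 1, 0; rewrite mulr0 mul0r.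
  - move=> x y [s [q [Ss e]]] [s' [q' [Ss' e']]]; exists (s * s'), (s' * q + s * q').
    split; first exact: SM.
    by transitivity (s' * (s * x) + s * (s' * y)); [ring|rewrite e e'; ring].
  - move=> r x [s [q [Ss e]]]; exists s, (r * q); split=> //.
    by rewrite mulrCA e mulrA.
(* The remainder of [x] by [h] lies in (x, h), so a generator of this ideal has smaller degree than
   [h]. It still divides [a], and by minimality of [h] it must be in [S]. *)
have Punit x : ~ P x -> exists u v, S (u * x + v * h).
  move=> nPx; pose J y := exists u v, y = u * x + v * h.
  have idJ : is_ideal J by apply: ideal2_is_ideal.
  have Jh : J h by exists 0, 1; ring.
  have [|h' [d' [[u [v h'E]] nh' Wh' min' div']]] := euc_principal idJ; first by exists h.
  have [s [q [Ss [e|[ne [d2 [lt Wd2]]]]]]] := euc_div eucS x nh Wh.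
    by case: nPx; exists s, q.
  have le : (d' <= d2)%N.
    by apply: min' Wd2 => //; exists s, (- q); ring.
  exists u, v; rewrite -h'E; apply: contrapT => nSh'.
  suff : (d <= d')%N by lia.
  apply: min; exists h'; split=> //; split=> // y ay.
  have [s1 [q1 [Ss1 e1]]] := hdiv y ay; have [s2 [q2 [Ss2 e2]]] := div' h Jh.
  exists (s2 * s1), (q1 * q2); split; first exact: SM.
  by rewrite -mulrA e1 mulrCA e2 mulrA.
exists P; split=> //; split=> //; first by move=> /PS; apply.
move=> x y Pxy; apply: contrapT => /not_orP[/Punit[u [v Sx]] /Punit[u' [v' Sy]]].
apply: (PS ((u * x + v * h) * (u' * y + v' * h))); last exact: SM.
have [_ PD PM] := idP.
have Ph : P h by exists 1, 1.
have -> : (u * x + v * h) * (u' * y + v' * h) =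
  (u * u') * (x * y) + (u * x * v' + v * u' * y + v * v' * h) * h by ring.
by apply: PD; apply: PM.
Qed.

(** Equivalence of matrices over the localization; with one factor on each side of the equation no
    inverse has to be named. *)
Definition mequiv k n (A B : 'M[R]_(k, n)) :=
  exists U V, [/\ S (\det U), S (\det V) & U *m A = B *m V].

Lemma mequiv_refl k n (A : 'M[R]_(k, n)) : mequiv A A.
Proof. by exists 1%:M, 1%:M; rewrite !det1 mul1mx mulmx1. Qed.

Lemma mequiv_trans k n (A B C : 'M[R]_(k, n)) :
  mequiv A B -> mequiv B C -> mequiv A C.
Proof.
move=> [U [V [SU SV e]]] [U' [V' [SU' SV' e']]]; exists (U' *m U), (V' *m V).
rewrite !det_mulmx; split; try exact: SM.
by rewrite -mulmxA e mulmxA e' mulmxA.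
Qed.

(** The determinant of [\adj U] divides a power of [\det U], and [S] is closed under divisors; thus
    scaled adjugates serve as inverses in [mequiv_sym]. *)
Lemma det_scale_adj_S n (U : 'M[R]_n) s : S s -> S (\det U) -> S (\det (s *: \adj U)).
Proof.
move=> Ss SU; rewrite detZ; apply: SM; first exact: euc_SX.
apply: (euc_Sdiv eucS (y := \det U)).
by rewrite -det_mulmx mul_adj_mx det_scalar; apply: euc_SX.
Qed.

Lemma mulmx_adj_swap k n (A B : 'M[R]_(k, n)) U V : U *m A = B *m V ->
  A *m (\det U *: \adj V) = (\det V *: \adj U) *m B.
Proof.
move=> e; transitivity (\adj U *m (U *m A) *m \adj V).
  by rewrite mulmxA mul_adj_mx mul_scalar_mx -scalemxAl scalemxAr.
by rewrite e -2!mulmxA mul_mx_adj mul_mx_scalar -scalemxAr scalemxAl.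
Qed.

Lemma mequiv_sym k n (A B : 'M[R]_(k, n)) : mequiv A B -> mequiv B A.
Proof.
move=> [U [V [SU SV e]]]; exists (\det V *: \adj U), (\det U *: \adj V).
split; try exact: det_scale_adj_S.
by rewrite (mulmx_adj_swap e).
Qed.

Lemma mequiv_mull k n (A : 'M[R]_(k, n)) U : S (\det U) -> mequiv A (U *m A).
Proof. by move=> SU; exists U, 1%:M; rewrite det1 mulmx1. Qed.

Lemma mequiv_mulr k n (A : 'M[R]_(k, n)) V : S (\det V) -> mequiv A (A *m V).
Proof.
by move=> SV; apply: mequiv_sym; exists 1%:M, V; rewrite det1 mul1mx.
Qed.

Lemma mequiv_tr k n (A B : 'M[R]_(k, n)) : mequiv A B -> mequiv A^T B^T.
Proof.
move=> [U [V [SU SV e]]]; apply: mequiv_sym; exists V^T, U^T.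
by rewrite !det_tr -!trmx_mul e.
Qed.

Lemma mequiv_xrow k n (A : 'M[R]_(k, n)) i j : mequiv A (xrow i j A).
Proof.
rewrite xrowE; apply: mequiv_mull; rewrite det_perm.
by apply/euc_SX/euc_SN1.
Qed.

Lemma mequiv_xcol k n (A : 'M[R]_(k, n)) i j : mequiv A (xcol i j A).
Proof.
rewrite xcolE; apply: mequiv_mulr; rewrite det_perm.
by apply/euc_SX/euc_SN1.
Qed.

(** A nonzero remainder of another entry of the first column could be produced by a row operation,
    and would have degree below the minimum over all equivalent matrices. Transposition gives the
    same for rows. *)
Lemma mequiv_min_divides k n (A B : 'M[R]_(1 + k, 1 + n)) d :
  (forall B i j d', mequiv A B -> B i j != 0 -> W (B i j) d' -> (d <= d')%N) ->
  mequiv A B -> B 0 0 != 0 -> W (B 0 0) d ->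
  forall i, exists s q, S s /\ s * B i 0 = q * B 0 0.
Proof.
move=> min AB nB WB i.
case: (split_ordP i) => {}i ->.
  by exists 1, 1; rewrite [i]ord1; have -> : lshift k 0 = 0 :> 'I_(1 + k) by apply: val_inj.
have [s [q [Ss [e|[ne [d' [lt Wd']]]]]]] := euc_div eucS (B (rshift 1 i) 0) nB WB.
  by exists s, q.
suff : (d <= d')%N by lia.
pose U := block_mx 1%:M 0 (- q *: delta_mx i 0) s%:M : 'M[R]_(1 + k).
have e : (U *m B) (rshift 1 i) 0 = s * B (rshift 1 i) 0 - q * B 0 0.
  rewrite -{1}[B]vsubmxK mul_block_col col_mxEd mul_scalar_mx -scalemxAl !mxE big_ord1 !mxE.
  rewrite !eqxx /= mul1r addrC mulNr; congr (_ - _ * B _ _); exact: val_inj.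
apply: (min (U *m B) (rshift 1 i) 0); rewrite ?e //.
apply: mequiv_trans AB _; apply: mequiv_mull.
by rewrite det_lblock det1 mul1r det_scalar; apply: euc_SX.
Qed.

(** The corner is a nonzero entry of least degree among all matrices equivalent to [A], not only in
    [A], so it stays minimal during the reduction and divides whatever can be moved into its row or
    column. *)
Lemma mequiv_corner k n (A : 'M[R]_(1 + k, 1 + n)) : A != 0 ->
  exists d A1, mequiv A (block_mx d%:M 0 0 (d *: A1)).
Proof.
move=> nA.
have [i [j nij]] : exists i j, A i j != 0.
  apply: contrapT => nex; case/eqP: nA; apply/matrixP => i j; rewrite mxE.
  by apply/eqP; apply: contra_notT nex => nij; exists i, j.
have [|d [[B [i0 [j0 [AB nB WB]]]] min0]] :=
    @ex_least (fun d => exists B i j, [/\ mequiv A B, B i j != 0 & W (B i j) d]).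
  have [d Wd] := euc_W eucS nij; exists d, A, i, j; split=> //; exact: mequiv_refl.
have min B1 i1 j1 d1 : mequiv A B1 -> B1 i1 j1 != 0 -> W (B1 i1 j1) d1 -> (d <= d1)%N.
  by move=> AB1 n1 W1; apply: min0; exists B1, i1, j1.
have minT B1 i1 j1 d1 : mequiv A^T B1 -> B1 i1 j1 != 0 -> W (B1 i1 j1) d1 -> (d <= d1)%N.
  move=> /mequiv_tr; rewrite trmxK => AB1 n1 W1; apply: (min B1^T j1 i1) => //; by rewrite mxE.
set e := B i0 j0 in nB WB.
pose B1 : 'M[R]_(1 + k, 1 + n) := xrow 0 i0 (xcol 0 j0 B).
have AB1 : mequiv A B1.
  apply: mequiv_trans AB _; apply: mequiv_trans (mequiv_xrow _ _ _).
  exact: mequiv_xcol.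
have B1e : B1 0 0 = e by rewrite !mxE !tpermL.
clearbody B1.
have rowdiv C : mequiv A C -> C 0 0 = e -> forall j, exists s q, S s /\ s * C 0 j = q * e.
  move=> AC Ce j1; have := mequiv_min_divides minT (mequiv_tr AC).
  by rewrite !mxE Ce => /(_ nB WB j1); rewrite mxE.
have zero0 m : lshift m 0 = 0 :> 'I_(1 + m) by apply: val_inj.
have [r [B2 AB2]] : exists r B2, mequiv A (block_mx e%:M r 0 B2).
  have := mequiv_min_divides min AB1; rewrite B1e => /(_ nB WB) cd.
  have [s [q [Ss sq]]] := euc_common (fun i : 'I_k => cd (rshift 1 i)).
  pose U := block_mx 1%:M 0 (- \col_i q i) s%:M : 'M[R]_(1 + k).
  have SU : S (\det U) by rewrite det_lblock det1 mul1r det_scalar; apply: euc_SX.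
  exists (ursubmx B1), (drsubmx (U *m B1)).
  have -> : block_mx e%:M (ursubmx B1) 0 (drsubmx (U *m B1)) = U *m B1.
    rewrite -[RHS]submxK; congr block_mx.
    - rewrite -[B1]submxK mulmx_block block_mxKul mul1mx mul0mx addr0.
      by rewrite [ulsubmx _]mx11_scalar !mxE zero0 zero0 B1e.
    - by rewrite -[in RHS](submxK B1) mulmx_block block_mxKur mul1mx mul0mx addr0.
    - rewrite -[B1]submxK mulmx_block block_mxKdl mulNmx mul_scalar_mx.
      apply/matrixP => u v; rewrite [v]ord1 !mxE big_ord1 !mxE zero0 zero0 B1e sq.
      by rewrite addrC subrr.
  exact: mequiv_trans AB1 (mequiv_mull _ SU).
have e00 (r' : 'M[R]_(1, n)) (c' : 'M[R]_(k, 1)) B' : block_mx e%:M r' c' B' 0 0 = e.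
  rewrite -[X in block_mx _ _ _ _ X _]zero0 -[X in block_mx _ _ _ _ _ X]zero0.
  by rewrite block_mxEul mxE eqxx.
have [B3 AB3] : exists B3, mequiv A (block_mx e%:M 0 0 B3).
  have cd := rowdiv _ AB2 (e00 _ _ _).
  have [s [q [Ss sq]]] := euc_common (fun j : 'I_n => cd (rshift 1 j)).
  pose V := block_mx 1%:M (- \row_j q j) 0 s%:M : 'M[R]_(1 + n).
  have SV : S (\det V) by rewrite det_ublock det1 mul1r det_scalar; apply: euc_SX.
  exists (s *: B2); have := mequiv_trans AB2 (mequiv_mulr _ SV).
  rewrite mulmx_block !mulmx1 !mul0mx !mulmx0 !addr0 add0r !mul_mx_scalar.
  rewrite mulmxN mul_scalar_mx.
  suff -> : - (e *: \row_j q j) + s *: r = 0 by [].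
  apply/rowP => v; have := sq v; rewrite -[X in block_mx _ _ _ _ X _]zero0 block_mxEur.
  by rewrite !mxE => ->; rewrite mulrC addNr.
(* Adding row [u] of [B3] to the first row keeps the corner [e], so [e] divides the entries of that
   row as well. *)
have [s [q [Ss sq]]] : exists s (q : 'I_k * 'I_n -> R), S s /\
    forall ij, s * B3 ij.1 ij.2 = q ij * e.
  apply: euc_common => -[u v] /=.
  pose U := block_mx 1%:M (delta_mx 0 u) 0 1%:M : 'M[R]_(1 + k).
  have SU : S (\det U) by rewrite det_ublock !det1 mulr1.
  have := mequiv_trans AB3 (mequiv_mull _ SU).
  rewrite mulmx_block !mul1mx !mul0mx !mulmx0 !addr0 !add0r => AB4.
  have := rowdiv _ AB4 (e00 _ _ _) (rshift 1 v).
  by rewrite -[X in block_mx _ _ _ _ X _]zero0 block_mxEur -rowE mxE.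
exists e, (\matrix_(u, v) q (u, v)).
pose U := block_mx 1%:M 0 0 s%:M : 'M[R]_(1 + k).
have SU : S (\det U) by rewrite det_ublock det1 det_scalar mul1r; apply: euc_SX.
have := mequiv_trans AB3 (mequiv_mull _ SU).
rewrite mulmx_block !mul1mx !mul0mx !mulmx0 !addr0 !add0r mul_scalar_mx.
suff -> : s *: B3 = e *: (\matrix_(u, v) q (u, v)) by [].
by apply/matrixP => u v; have := sq (u, v); rewrite !mxE /= mulrC => ->; rewrite mulrC.
Qed.

Definition diag_rect k n (delta : nat -> R) : 'M[R]_(k, n) :=
  \matrix_(i, j) (delta i *+ (i == j :> nat)).

Lemma smith k n (A : 'M[R]_(k, n)) : exists delta : nat -> R,
  (forall i, exists c, delta i.+1 = c * delta i) /\ mequiv A (diag_rect k n delta).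
Proof.
have zero m p : exists delta : nat -> R, (forall i, exists c, delta i.+1 = c * delta i) /\
    mequiv (0 : 'M_(m, p)) (diag_rect m p delta).
  exists (fun _ => 0); split; first by exists 0; rewrite mulr0.
  have -> : diag_rect m p (fun _ => 0) = 0 by apply/matrixP => i j; rewrite !mxE mul0rn.
  exact: mequiv_refl.
elim: k n A => [|k IH] [|n] A; try by rewrite ?[A]flatmx0 ?[A]thinmx0.
case: (eqVneq A 0) => [->//|/mequiv_corner[d [A1 AE]]].
have [delta [dvd [U [V [SU SV e]]]]] := IH n A1.
exists (fun i => if i is i'.+1 then d * delta i' else d); split.
  case=> [|i]; first by exists (delta 0%N); rewrite mulrC.
  by have [c ->] := dvd i; exists c; rewrite mulrCA.
apply: mequiv_trans AE _.
exists (block_mx 1%:M 0 0 U : 'M_(1 + k)), (block_mx 1%:M 0 0 V : 'M_(1 + n)).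
rewrite !det_ublock !det1 !mul1r; split=> //.
set F := fun i => _.
have dE : diag_rect (1 + k) (1 + n) F = block_mx (d%:M : 'M_1) 0 0 (d *: diag_rect k n delta).
  apply/matrixP => i j; case: (split_ordP i) => {}i ->; case: (split_ordP j) => {}j ->.
  - by rewrite block_mxEul !mxE !ord1 /= mulr1n.
  - by rewrite block_mxEur !mxE /= [i]ord1.
  - by rewrite block_mxEdl !mxE /= [j]ord1.
  - by rewrite block_mxEdr !mxE /= eqSS mulrnAr.
rewrite [diag_rect _ _ F]dE.
rewrite !mulmx_block !mul1mx !mulmx1 !mul0mx !mulmx0 !addr0 !add0r.
by rewrite -scalemxAr e scalemxAl.
Qed.

(** * Determinantal ideals and recovery of the invariant factors *)

Section Diagonal.
Variable delta : nat -> R.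
Hypothesis delta_dvd : forall i, exists c, delta i.+1 = c * delta i.

Lemma diag_dvd i j : (i <= j)%N -> exists c, delta j = c * delta i.
Proof.
move=> /subnKC <-; elim: (j - i)%N => [|m [c e]].
  by exists 1; rewrite addn0 mul1r.
by have [c' e'] := delta_dvd (i + m)%N; exists (c' * c); rewrite addnS e' e mulrA.
Qed.

(** Pigeonhole: some value of [f] is at least r - 1, and its [delta] is a multiple of the last
    factor on the right; induction removes this pair. *)
Lemma prod_diag_dvd r (f : 'I_r -> nat) : injective f ->
  exists c, \prod_a delta (f a) = c * \prod_(a < r) delta a.
Proof.
elim: r f => [|r IH] f inj; first by exists 1; rewrite !big_ord0 mulr1.
have [a0 le] : exists a0, (r <= f a0)%N.
  apply: contrapT => nex.
  have lt a : (f a < r)%N by rewrite ltnNge; apply/negP => le; apply: nex; exists a.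
  have : injective (fun a => Ordinal (lt a)) by move=> a b [] /inj.
  by move/leq_card; rewrite !card_ord ltnn.
have [|c e] := IH (f \o lift a0); first by apply: inj_comp => //; apply: lift_inj.
have [c' e'] := diag_dvd le.
exists (c' * c); rewrite (bigD1_ord a0) //= [X in _ * X]e e' big_ord_recr /=.
by ring.
Qed.

(** A square submatrix of a diagonal matrix is a diagonal matrix times a 0-1 matrix. Together with
    [prod_diag_minor] this makes the ideal of r-minors principal. *)
Lemma minor_ideal_diag k n r x : minor_ideal (diag_rect k n delta) r x ->
  exists c, x = c * \prod_(a < r) delta a.
Proof.
move: x; apply: gen_ideal_min.
  split; first by exists 0; rewrite mul0r.
    by move=> _ _ [c ->] [c' ->]; exists (c + c'); rewrite mulrDl.
  by move=> s _ [c ->]; exists (s * c); rewrite mulrA.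
move=> x [f [h [finj _ ->]]].
have -> : \matrix_(a, b) (diag_rect k n delta) (f a) (h b) =
    diag_mx (\row_a delta (f a)) *m \matrix_(a, b) ((f a == h b :> nat)%:R).
  by rewrite mul_diag_mx; apply/matrixP => a b; rewrite !mxE mulr_natr.
rewrite det_mulmx det_diag.
have [|c e] := @prod_diag_dvd _ (fun a => f a : nat).
  by move=> a b /val_inj/finj.
under eq_bigr => a _ do rewrite mxE.
by rewrite e; eexists; rewrite mulrC mulrA.
Qed.

Lemma prod_diag_minor k n r : (r <= k)%N -> (r <= n)%N ->
  minor_ideal (diag_rect k n delta) r (\prod_(a < r) delta a).
Proof.
move=> rk rn.
have := minor_ideal_mxsub (diag_rect k n delta) (widen_ord rk) (widen_ord rn).
suff -> : mxsub (widen_ord rk) (widen_ord rn) (diag_rect k n delta) =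
    diag_mx (\row_(a < r) delta a).
  by rewrite det_diag; under eq_bigr => a _ do rewrite mxE.
by apply/matrixP => a b; rewrite !mxE.
Qed.

End Diagonal.

(** From U A = B V one gets det V B = U A adj V, and r-minors are homogeneous of degree [r]. *)
Lemma mequiv_minor_ideal k n (A B : 'M[R]_(k, n)) r : mequiv A B ->
  exists s, S s /\ forall x, minor_ideal B r x -> minor_ideal A r (s * x).
Proof.
move=> [U [V [SU SV e]]]; exists (\det V ^+ r); split; first exact: euc_SX.
apply: gen_ideal_min => [|x [f [h [_ _ ->]]]].
  exact/is_ideal_quot/minor_ideal_is_ideal.
apply: (@minor_ideal_mull _ _ _ _ U); apply: (@minor_ideal_mulr _ _ _ _ _ (\adj V)).
rewrite e -mulmxA mul_mx_adj mul_mx_scalar.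
have -> : \det V ^+ r * \det (\matrix_(a, b) B (f a) (h b)) =
    \det (mxsub f h (\det V *: B)).
  by rewrite -detZ; congr determinant; apply/matrixP => i j; rewrite !mxE.
exact: minor_ideal_mxsub.
Qed.

Lemma diag_S_dvd k n (A B : 'M[R]_(k, n)) (delta eps : nat -> R) :
  (n <= k)%N ->
  (forall i, exists c, eps i.+1 = c * eps i) ->
  mequiv A (diag_rect k n delta) -> mequiv B (diag_rect k n eps) ->
  (forall r, (r <= n)%N -> exists s, S s /\
     forall x, minor_ideal A r x -> minor_ideal B r (s * x)) ->
  forall r, (r <= n)%N ->
  exists s c, S s /\ s * \prod_(a < r) delta a = c * \prod_(a < r) eps a.
Proof.
move=> nk deps Ad Be AB r rn.
have [s1 [Ss1 H1]] := mequiv_minor_ideal r Ad.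
have [s2 [Ss2 H2]] := AB r rn.
have [s3 [Ss3 H3]] := mequiv_minor_ideal r (mequiv_sym Be).
have := H3 _ (H2 _ (H1 _ (prod_diag_minor delta (leq_trans rn nk) rn))).
move=> /(minor_ideal_diag deps)[c e]; exists (s3 * s2 * s1), c; split.
  by do 2![apply: SM => //].
by rewrite -e; ring.
Qed.

Lemma diag_prod_neq0 k n (A : 'M[R]_(k, n)) (delta : nat -> R) :
  (forall i, exists c, delta i.+1 = c * delta i) ->
  mequiv A (diag_rect k n delta) ->
  (exists x, x != 0 /\ minor_ideal A n x) ->
  forall r, (r <= n)%N -> \prod_(a < r) delta a != 0.
Proof.
move=> dd Ad [x [nx mx]] r rn.
have [s [Ss H]] := mequiv_minor_ideal n (mequiv_sym Ad).
have [c e] := minor_ideal_diag dd (H x mx).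
have : s * x != 0 by apply: euc_mul_neq0 => //; apply: euc_S_neq0.
rewrite e => ne; apply/eqP => p0; case/eqP: ne.
rewrite -(subnKC rn) big_split_ord /= [X in c * (X * _)]p0.
by rewrite mul0r mulr0.
Qed.

(** The product of the first [r] invariant factors is determined up to [S] by the r-minors, and
    quotients of consecutive products give the factors themselves. The nonzero n-minors permit the
    cancellation. *)
Lemma mequiv_of_minors k n (A B : 'M[R]_(k, n)) : (n <= k)%N ->
  (exists x, x != 0 /\ minor_ideal A n x) ->
  (exists x, x != 0 /\ minor_ideal B n x) ->
  (forall r, (r <= n)%N -> exists s, S s /\
     forall x, minor_ideal A r x -> minor_ideal B r (s * x)) ->
  (forall r, (r <= n)%N -> exists s, S s /\
     forall x, minor_ideal B r x -> minor_ideal A r (s * x)) ->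
  mequiv A B.
Proof.
move=> nk nzA nzB AB BA.
have [delta [dd Ad]] := smith A; have [eps [de Be]] := smith B.
have dS r : (r < n)%N -> exists s c, [/\ S s, S c & s * delta r = c * eps r].
  have step (x y : nat -> R) : (forall r, (r <= n)%N -> \prod_(a < r) x a != 0) ->
      (forall r, (r <= n)%N -> exists s c,
         S s /\ s * \prod_(a < r) x a = c * \prod_(a < r) y a) ->
      (forall r, (r <= n)%N -> exists s c,
         S s /\ s * \prod_(a < r) y a = c * \prod_(a < r) x a) ->
      forall r, (r < n)%N -> exists s c, S s /\ s * x r = c * y r.
    move=> nx xy yx q qn.
    have [s [c [Ss]]] := xy q.+1 qn; have [s' [c' [Ss' e']]] := yx q (ltnW qn).
    rewrite !big_ord_recr /= => e.
    exists (s * s'), (c * c'); split; first exact: SM.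
    apply: (euc_mulIf (nx q (ltnW qn))).
    transitivity (s' * (s * (\prod_(i < q) x i * x q))); first by ring.
    rewrite e; transitivity (c * y q * (s' * \prod_(i < q) y i)); first by ring.
    by rewrite e'; ring.
  move=> rn.
  have nzd := diag_prod_neq0 dd Ad nzA; have nze := diag_prod_neq0 de Be nzB.
  have dAB := diag_S_dvd nk de Ad Be AB; have dBA := diag_S_dvd nk dd Be Ad BA.
  have [s [c [Ss e]]] := step _ _ nzd dAB dBA r rn.
  have [t [c' [St e']]] := step _ _ nze dBA dAB r rn.
  (* Divisibility holds in both directions, so [c] divides s t and hence lies in [S]. *)
  exists s, c; split=> //; apply: (euc_Sdiv eucS (y := c')).
  have ndr : delta r != 0.
    by apply/eqP => d0; have := nzd _ rn; rewrite big_ord_recr /= d0 mulr0 eqxx.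
  have -> : c * c' = s * t; last exact: SM.
  apply: (euc_mulIf ndr); transitivity (c * (c' * delta r)); first by ring.
  by rewrite -e' mulrCA -e; ring.
have /choice[s /choice[c sc]] r : exists s c,
   [/\ S s, S c & (r < n)%N -> s * delta r = c * eps r].
  case: (ltnP r n) => [/dS[s [c [Ss Sc e]]]|_]; first by exists s, c.
  by exists 1, 1.
apply: mequiv_trans Ad _; apply: mequiv_trans (mequiv_sym Be).
exists (diag_mx (\row_i s i)), (diag_mx (\row_i c i)); rewrite !det_diag.
split; try by apply: big_ind => // i _; rewrite mxE; case: (sc i).
rewrite mul_diag_mx mul_mx_diag; apply/matrixP => i j; rewrite !mxE.
case: eqVneq => [eij|]; last by rewrite !mulr0n mulr0 mul0r.
rewrite !mulr1n eij; case: (sc j) => _ _ ->; last exact: ltn_ord.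
by rewrite mulrC.
Qed.

(** [V] induces [h], and its inverse up to [S], [\det U *: \adj V], induces [f]; the common scalar
    is det U det V. *)
Lemma mequiv_isogeny (M N : lmodType R) k n (g : 'I_n -> M) (g' : 'I_n -> N)
    (A B : 'M[R]_(k, n)) :
  is_presentation g A -> is_presentation g' B -> mequiv A B ->
  exists (f : {linear M -> N}) (h : {linear N -> M}) s,
    [/\ S s, forall x, h (f x) = s *: x & forall y, f (h y) = s *: y].
Proof.
move=> pA pB [U [V [SU SV e]]].
have [h hE] := linear_of_matrix pB pA (esym e).
have eA : A *m (\det U *: \adj V) = (\det V *: \adj U) *m B.
  by rewrite (mulmx_adj_swap e).
have [f fE] := linear_of_matrix pA pB eA.
exists f, h, (\det U * \det V); split; first exact: SM.
  have [genA _] := (presentationP g A).1 pA.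
  move=> x; have [c ->] := genA x.
  rewrite fE hE -mulmxA -scalemxAl mul_adj_mx scale_scalar_mx mul_mx_scalar.
  by rewrite lincombZ.
have [genB _] := (presentationP g' B).1 pB.
move=> x; have [c ->] := genB x.
rewrite hE fE -mulmxA -scalemxAr mul_mx_adj scale_scalar_mx mul_mx_scalar.
by rewrite lincombZ.
Qed.

End Euclidean.

(** * The ring of power series *)

Section Uniformizer.
Variables (O : idomainType) (pi : O).
Hypothesis unif : is_uniformizer pi.

Lemma uniformizer_unit x : ~ rdivides pi x -> x \is a GRing.unit.
Proof.
move=> ndvd; have nx : x != 0.
  by apply/eqP => x0; apply: ndvd; exists 0; rewrite mul0r.
have [_ [_ /(_ x nx)[u [[|n] [uu xE]]]]] := unif; first by rewrite xE expr0 mulr1.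
by case: ndvd; exists (u * pi ^+ n); rewrite xE exprSr mulrA.
Qed.

Lemma uniformizer_ndvd_unit x : x \is a GRing.unit -> ~ rdivides pi x.
Proof.
move=> ux [c cE]; have [_ [npi _]] := unif; case/negP: npi.
by move: ux; rewrite cE unitrM => /andP[].
Qed.

Lemma uniformizer_prime x y : rdivides pi (x * y) -> rdivides pi x \/ rdivides pi y.
Proof.
move=> dvd; apply: contrapT => /not_orP[/uniformizer_unit ux /uniformizer_unit uy].
by apply: (@uniformizer_ndvd_unit (x * y)) => //; rewrite unitrM ux.
Qed.

Lemma uniformizer_separated x : (forall k, rdivides (pi ^+ k) x) -> x = 0.
Proof.
move=> dvd; apply: contrapT => /eqP nx.
have [npi [_ /(_ x nx)[u [n [uu xE]]]]] := unif.
have [c cE] := dvd n.+1.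
apply: (uniformizer_ndvd_unit uu); exists c.
apply: (mulIf (expf_neq0 n npi)); rewrite -xE cE exprS; ring.
Qed.

End Uniformizer.

Section PowerSeries.
Variables (O : idomainType) (L : comNzRingType) (coef : L -> nat -> O).
Hypothesis ps : is_power_series_ring coef.

Lemma coef_inj a b : coef a =1 coef b -> a = b.
Proof. by case: ps => inj _ _ _ _; apply: inj. Qed.

Lemma coef_surj s : exists a, coef a =1 s.
Proof. by case: ps. Qed.

Definition series s : L := sval (cid (coef_surj s)).

Lemma coef_series s : coef (series s) =1 s.
Proof. by rewrite /series; case: cid. Qed.

Lemma coefD a b n : coef (a + b) n = coef a n + coef b n.
Proof. by case: ps. Qed.

Lemma coefM a b n : coef (a * b) n = \sum_(i < n.+1) coef a i * coef b (n - i)%N.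
Proof. by case: ps. Qed.

Lemma coef1 n : coef 1 n = (n == 0%N)%:R.
Proof. by case: ps. Qed.

Lemma coef0 n : coef 0 n = 0.
Proof.
have := coefD 0 0 n; rewrite addr0 => /eqP.
by rewrite -subr_eq0 opprD addrA subrr sub0r oppr_eq0 => /eqP.
Qed.

Lemma coefB a b n : coef (a - b) n = coef a n - coef b n.
Proof. by apply/eqP; rewrite eq_sym subr_eq -coefD subrK. Qed.

Lemma coef_sum K (F : 'I_K -> L) n : coef (\sum_k F k) n = \sum_k coef (F k) n.
Proof.
by apply: (big_morph (fun x => coef x n)) => [x y|]; [apply: coefD|apply: coef0].
Qed.

Definition psC c : L := series (fun n => if n is 0%N then c else 0).
Definition psT : L := series (fun n => (n == 1%N)%:R).

Lemma coef_psCM c x n : coef (psC c * x) n = c * coef x n.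
Proof.
rewrite coefM big_ord_recl big1 => [|i _]; last by rewrite coef_series mul0r.
by rewrite coef_series addr0 subn0.
Qed.

Lemma coef_psCXM c k x n : coef (psC c ^+ k * x) n = c ^+ k * coef x n.
Proof.
by elim: k => [|k IH]; rewrite ?expr0 ?mul1r // !exprS -!mulrA coef_psCM IH.
Qed.

Lemma coef_psTM x n : coef (psT * x) n = if n is m.+1 then coef x m else 0.
Proof.
rewrite coefM; case: n => [|n]; first by rewrite big_ord1 coef_series mul0r.
rewrite big_ord_recl coef_series mul0r add0r big_ord_recl big1 => [|i _].
  by rewrite coef_series mul1r addr0 /= subSS subn0.
by rewrite coef_series mul0r.
Qed.

Lemma coef_psTXM d x n : coef (psT ^+ d * x) n = if (n < d)%N then 0 else coef x (n - d).
Proof.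
elim: d n => [|d IH] n; first by rewrite expr0 mul1r subn0.
by rewrite exprS -mulrA coef_psTM; case: n => [//|n]; rewrite IH.
Qed.

Lemma low_high_split d g : exists low high,
  [/\ g = low + psT ^+ d * high, forall n, (d <= n)%N -> coef low n = 0,
      forall n, (n < d)%N -> coef low n = coef g n & forall n, coef high n = coef g (n + d)].
Proof.
pose high := series (fun n => coef g (n + d)).
exists (g - psT ^+ d * high), high; split=> [|n dn|n nd|n]; first by rewrite subrK.
- by rewrite coefB coef_psTXM ltnNge dn /= coef_series subnK // subrr.
- by rewrite coefB coef_psTXM nd subr0.
- exact: coef_series.
Qed.

Lemma series_unit x : coef x 0%N \is a GRing.unit -> exists y, x * y = 1.
Proof.
move=> ux.
(* [ys n] lists the first n + 1 coefficients of the inverse; [next] is the coefficient forced by the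
   vanishing of the next coefficient of the product. *)
pose next (s : seq O) :=
  - (coef x 0%N)^-1 * \sum_(i < size s) coef x (size s - i)%N * s`_i.
pose ys n := iter n (fun s => rcons s (next s)) [:: (coef x 0%N)^-1].
have sz n : size (ys n) = n.+1 by elim: n => //= n; rewrite size_rcons => ->.
have stable m n : (m <= n)%N -> (ys n)`_m = (ys m)`_m.
  move=> /subnKC <-; elim: (n - m)%N => [|j IH]; first by rewrite addn0.
  by rewrite addnS /= nth_rcons sz ltnS leq_addr.
pose y := series (fun n => (ys n)`_n).
exists y; apply: coef_inj => n; rewrite mulrC coefM coef1; case: n => [|n].
  by rewrite big_ord1 coef_series /= mulVr.
rewrite big_ord_recr /= subnn coef_series [ys n.+1]/= nth_rcons sz ltnn eqxx.
rewrite /next sz mulrAC mulNr mulVr // mulN1r; apply/eqP; rewrite subr_eq0; apply/eqP.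
apply: eq_bigr => i _; rewrite coef_series mulrC stable //.
by rewrite -ltnS.
Qed.

(** Gauss's lemma: if [i] and [j] are the first indices with coefficients outside [Z], then in
    degree i + j every product but one is in [Z]. Applied to the zero ideal and to the ideal of
    pi. *)
Lemma coef_prime (Z : O -> Prop) a b :
  Z 0 -> (forall x y, Z x -> Z y -> Z (x + y)) -> (forall x y, Z x -> Z (x * y)) ->
  (forall x y, Z (x * y) -> Z x \/ Z y) ->
  (forall n, Z (coef (a * b) n)) -> (forall n, Z (coef a n)) \/ (forall n, Z (coef b n)).
Proof.
move=> Z0 ZD ZM Zp Zab; apply: contrapT => /not_orP[/existsNP[i0 Zi0] /existsNP[j0 Zj0]].
have [|i [Zi mini]] := @ex_least (fun i => ~ Z (coef a i)); first by exists i0.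
have [|j [Zj minj]] := @ex_least (fun i => ~ Z (coef b i)); first by exists j0.
have lei : (i < (i + j).+1)%N by lia.
have := Zab (i + j)%N; rewrite coefM (bigD1 (Ordinal lei)) //= addKn => Zs.
set r := \sum_(u < _ | _) _ in Zs.
suff Zr : Z r.
  have : Z (coef a i * coef b j).
    rewrite -[X in Z X](addrK r); apply: ZD => //.
    by rewrite -mulN1r mulrC; apply: ZM.
  by case/Zp.
apply: big_ind => // u ne.
have {}ne : (u != i :> nat) by apply: contra_neq ne => ui; apply: val_inj.
case: (ltnP u i) => [ui|iu].
  by apply: ZM; apply: contrapT => /mini; lia.
rewrite mulrC; apply: ZM; apply: contrapT => /minj; have := ltn_ord u; lia.
Qed.

Lemma series_domain (x y : L) : x * y = 0 -> x = 0 \/ y = 0.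
Proof.
move=> xy0.
have [|||||x0|y0] := @coef_prime (fun c => c = 0) x y => //.
- by move=> ? ? -> ->; rewrite addr0.
- by move=> ? ? ->; rewrite mul0r.
- by move=> u v /eqP; rewrite mulf_eq0 => /orP[] /eqP; [left|right].
- by move=> n; rewrite xy0 coef0.
- by left; apply: coef_inj => n; rewrite x0 coef0.
- by right; apply: coef_inj => n; rewrite y0 coef0.
Qed.

(** * Divisibility by the uniformizer *)

Variable pi : O.
Hypothesis unif : is_uniformizer pi.
Hypothesis compl : pi_adically_complete pi.

Local Notation P := (psC pi).

Lemma psC_dvdP k x : (exists y, x = P ^+ k * y) <-> forall n, rdivides (pi ^+ k) (coef x n).
Proof.
split=> [[y ->] n|/choice[c cE]]; first by exists (coef y n); rewrite coef_psCXM mulrC.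
by exists (series c); apply: coef_inj => n; rewrite coef_psCXM coef_series cE mulrC.
Qed.

Definition pi_dvd x := exists y : L, x = P * y.

Lemma pi_dvdP x : pi_dvd x <-> forall n, rdivides pi (coef x n).
Proof. by have := psC_dvdP 1 x; rewrite !expr1. Qed.

Lemma pi_dvd_ideal : is_ideal pi_dvd.
Proof.
split; first by exists 0; rewrite mulr0.
  by move=> _ _ [x ->] [y ->]; exists (x + y); rewrite mulrDr.
by move=> r _ [x ->]; exists (r * x); rewrite mulrCA.
Qed.

Lemma pi_neq0 k : P ^+ k != 0.
Proof.
apply/eqP => e; have := coef0 0; rewrite -e -[P ^+ k]mulr1 coef_psCXM coef1 mulr1.
by apply/eqP; apply: expf_neq0; case: unif.
Qed.

Lemma pi_ndvd1 : ~ pi_dvd 1.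
Proof.
move=> /pi_dvdP/(_ 0%N); rewrite coef1.
exact: (uniformizer_ndvd_unit unif (unitr1 _)).
Qed.

Lemma pi_ndvdT : ~ pi_dvd psT.
Proof.
move=> /pi_dvdP/(_ 1%N); rewrite coef_series.
exact: (uniformizer_ndvd_unit unif (unitr1 _)).
Qed.

Lemma pi_dvd_prime : is_prime_ideal pi_dvd.
Proof.
split; [exact: pi_dvd_ideal|exact: pi_ndvd1|move=> x y /pi_dvdP xy].
have [|||||/pi_dvdP|/pi_dvdP] := @coef_prime (rdivides pi) x y => //; [..|by left|by right].
- by exists 0; rewrite mul0r.
- by move=> _ _ [c ->] [d ->]; exists (c + d); rewrite mulrDl.
- by move=> _ d [c ->]; exists (c * d); rewrite mulrAC.
- exact: uniformizer_prime.
Qed.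

Lemma series_cancel (z x y : L) : z != 0 -> z * x = z * y -> x = y.
Proof.
move=> nz e; have /series_domain[z0|] : z * (x - y) = 0 by rewrite mulrBr e subrr.
  by rewrite z0 eqxx in nz.
by move/eqP; rewrite subr_eq0 => /eqP.
Qed.

Lemma pi_factor x : x != 0 -> exists k y, x = P ^+ k * y /\ ~ pi_dvd y.
Proof.
move=> nx.
have [n nxn] : exists n, coef x n != 0.
  apply: contrapT => nex; case/eqP: nx; apply: coef_inj => n; rewrite coef0.
  by apply/eqP; apply: contra_notT nex => nn; exists n.
have [|k [nk mink]] := @ex_least (fun k => ~ exists y, x = P ^+ k.+1 * y).
  have : ~ forall k, rdivides (pi ^+ k) (coef x n).
    by move=> /(uniformizer_separated unif); apply/eqP.
  move=> /existsNP[[|k] nk]; first by case: nk; exists (coef x n); rewrite expr0 mulr1.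
  by exists k => /psC_dvdP/(_ n).
have [y yE] : exists y, x = P ^+ k * y.
  case: k nk mink => [|k] nk mink; first by exists x; rewrite expr0 mul1r.
  by apply: contrapT => /mink; rewrite ltnn.
exists k, y; split=> // -[z zE]; apply: nk; exists z.
by rewrite yE zE exprSr mulrA.
Qed.

(** * Order modulo pi, Weierstrass division and finite generation of ideals *)

Definition wdeg x d :=
  (forall i, (i < d)%N -> rdivides pi (coef x i)) /\ coef x d \is a GRing.unit.

Lemma wdeg_exists x : ~ pi_dvd x -> exists d, wdeg x d.
Proof.
move=> /pi_dvdP/existsNP[n nn].
have [|d [nd mind]] := @ex_least (fun d => ~ rdivides pi (coef x d)); first by exists n.
exists d; split; last exact: uniformizer_unit nd.
by move=> i id; apply: contrapT => /mind; lia.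
Qed.

(** Modulo pi, x is a unit times T^d; this weak form of Weierstrass preparation is the one used
    throughout. *)
Lemma wdeg_split x d : wdeg x d ->
  exists u v w, x = psT ^+ d * u + P * v /\ u * w = 1.
Proof.
move=> [low unit_d].
have [l [u [xE l0 lx uE]]] := low_high_split d x.
have [w uw] : exists w, u * w = 1 by apply: series_unit; rewrite uE add0n.
have [v vE] : pi_dvd l.
  apply/pi_dvdP => n; case: (ltnP n d) => [nd|dn]; first by rewrite lx //; apply: low.
  by rewrite l0 //; exists 0; rewrite mul0r.
by exists u, v, w; rewrite -vE addrC.
Qed.

Lemma pi_adic_sum (z : nat -> L) :
  exists Z, forall K, exists y, Z = \sum_(k < K) P ^+ k * z k + P ^+ K * y.
Proof.
pose x n K := \sum_(k < K) pi ^+ k * coef (z k) n.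
have xdvd n K j : rdivides (pi ^+ K) (x n (K + j)%N - x n K).
  elim: j => [|j [c cE]]; first by exists 0; rewrite addn0 subrr mul0r.
  exists (c + pi ^+ j * coef (z (K + j)%N) n).
  rewrite addnS /x big_ord_recr /= -/(x n (K + j)%N) -/(x n K).
  by rewrite addrAC cE exprD; ring.
have xdvd2 n K m : (K <= m)%N -> rdivides (pi ^+ K) (x n m - x n K).
  by move=> /subnKC <-; apply: xdvd.
have dvdB (q a b : O) : rdivides q a -> rdivides q b -> rdivides q (a - b).
  by move=> [c ->] [d ->]; exists (c - d); rewrite mulrBl.
have lim n : exists l, forall K, rdivides (pi ^+ K) (l - x n K).
  have [|l lE] := compl (x := x n).
    move=> k; exists k => m p km kp.
    have -> : x n m - x n p = (x n m - x n k) - (x n p - x n k) by ring.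
    by apply: dvdB; apply: xdvd2.
  exists l => K; have [N NE] := lE K.
  (* Completeness controls the partial sums only from some [N] on; passing through the index
     [maxn N K] brings the congruence modulo pi^K back to [K] itself. *)
  have -> : l - x n K = (x n (maxn N K) - x n K) - (x n (maxn N K) - l) by ring.
  apply: dvdB; first by apply: xdvd2; rewrite leq_maxr.
  have [c cE] := NE (maxn N K) (leq_maxl _ _).
  by exists (- c); rewrite mulNr -cE opprB.
have [l lE] := choice lim.
exists (series l) => K.
have [y yE] : exists y, series l - \sum_(k < K) P ^+ k * z k = P ^+ K * y.
  apply/psC_dvdP => n; rewrite coefB coef_series coef_sum.
  by under eq_bigr => k _ do rewrite coef_psCXM.
by exists y; rewrite -yE addrC subrK.
Qed.

Lemma pi_adic_separated x : (forall K, exists y, x = P ^+ K * y) -> x = 0.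
Proof.
move=> dvd; apply: coef_inj => n; rewrite coef0; apply: (uniformizer_separated unif) => k.
exact: (psC_dvdP k x).1.
Qed.

(* A division with error term divisible by [pi] can be repeated on the error term. *)
Lemma pi_adic_division f d (Q : L -> Prop) :
  (forall g, Q g -> exists q r g',
     [/\ Q g', g = q * f + r + P * g' & forall n, (d <= n)%N -> coef r n = 0]) ->
  forall g, Q g -> exists q r,
     g = q * f + r /\ forall n, (d <= n)%N -> coef r n = 0.
Proof.
move=> step g Qg.
(* A dummy triple outside [Q] makes the step total, so that [gs] can iterate it on the error
   terms. *)
have /choice[t tE] (g0 : L) : exists t : L * L * L, Q g0 ->
    [/\ Q t.2, g0 = t.1.1 * f + t.1.2 + P * t.2 & forall n, (d <= n)%N -> coef t.1.2 n = 0].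
  case: (EM (Q g0)) => [/step[q [r [g' H]]]|nQ]; first by exists (q, r, g').
  by exists (0, 0, 0).
pose gs k := iter k (fun g0 => (t g0).2) g.
have Qgs k : Q (gs k) by elim: k => //= k IH; case: (tE _ IH).
have part K : g = (\sum_(k < K) P ^+ k * (t (gs k)).1.1) * f
    + \sum_(k < K) P ^+ k * (t (gs k)).1.2 + P ^+ K * gs K.
  elim: K => [|K IH]; first by rewrite !big_ord0 mul0r !add0r expr0 mul1r.
  have -> : gs K.+1 = (t (gs K)).2 by [].
  case: (tE _ (Qgs K)) => _ e _; rewrite !big_ord_recr [LHS]IH exprS.
  by rewrite [in P ^+ K * gs K]e /=; ring.
have [q qE] := pi_adic_sum (fun k => (t (gs k)).1.1).
have [r rE] := pi_adic_sum (fun k => (t (gs k)).1.2).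
exists q, r; split; last first.
  move=> n dn; apply: (uniformizer_separated unif) => K; have [y ->] := rE K.
  rewrite coefD coef_sum big1 ?add0r => [|k _].
    by exists (coef y n); rewrite coef_psCXM mulrC.
  by rewrite coef_psCXM; case: (tE _ (Qgs k)) => _ _ ->; rewrite ?mulr0.
apply/eqP; rewrite -subr_eq0; apply/eqP/pi_adic_separated => K.
have [y yE] := qE K; have [z zE] := rE K.
by exists (gs K - y * f - z); rewrite [g](part K) yE zE; ring.
Qed.

Lemma weierstrass_division f d : wdeg f d ->
  forall g, exists q r, g = q * f + r /\ forall n, (d <= n)%N -> coef r n = 0.
Proof.
move=> /wdeg_split[u [v [w [fE uw]]]] g.
apply: (@pi_adic_division f d (fun _ => True)) => // {}g _.
have [l [h [gE l0 _ _]]] := low_high_split d g.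
(* Since T^d = w (f - pi v), the high part T^d h is a multiple of [f] up to an error divisible by
   pi. *)
exists (w * h), l, (- (w * h * v)); split=> //.
rewrite [LHS]gE fE.
transitivity (l + psT ^+ d * h * (u * w)); first by rewrite uw mulr1.
by ring.
Qed.

(** Modulo pi the ring is a power series ring over the residue field, where smaller order means
    divisibility. *)
Lemma wdeg_dvd_mod f g d : wdeg f d ->
  (forall e, wdeg g e -> (d <= e)%N) -> exists h g', g = h * f + P * g'.
Proof.
move=> /wdeg_split[u [v [w [fE uw]]]] min.
case: (EM (pi_dvd g)) => [[g' ->]|/wdeg_exists[e we]].
  by exists 0, g'; rewrite mul0r add0r.
have [u' [v' [_ [gE _]]]] := wdeg_split we.
exists (psT ^+ (e - d) * u' * w), (v' - psT ^+ (e - d) * u' * w * v).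
rewrite gE fE -(subnKC (min e we)) exprD addKn.
transitivity (psT ^+ d * psT ^+ (e - d) * u' * (u * w) + P * v'); first by rewrite uw mulr1.
by ring.
Qed.

(** Modulo pi, [I] is generated by one element, of least order; what lies in (pi) is governed by the
    quotient ideal (I : pi). *)
Lemma fin_gen_ideal_step I : is_ideal I ->
  fin_gen_ideal (fun g => I (P * g)) -> fin_gen_ideal I.
Proof.
move=> idI fgJ; have [I0 ID IM] := idI.
case: (EM (exists d f, I f /\ wdeg f d)) => [/ex_least[d [[f [If wf]] min]]|nex].
  apply: (fin_gen_ideal_cons (a := P) idI If _ fgJ) => // g Ig.
  have [e we|h [g' gE]] := @wdeg_dvd_mod f g d wf; first by apply: min; exists g.
  exists h, g'; split=> //; have -> : P * g' = g - h * f by rewrite gE; ring.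
  by apply: is_idealB => //; apply: IM.
apply: (fin_gen_ideal_cons (a := P) idI I0 _ fgJ) => // g Ig.
have [g' gE] : pi_dvd g.
  by apply: contrapT => /wdeg_exists[d wd]; apply: nex; exists d, g.
by exists 0, g'; rewrite -gE mulr0 add0r.
Qed.

(** Let [f] in (I : pi^K) have the least Weierstrass degree over all (I : pi^k). Then [f] alone
    generates (I : pi^K), and [fin_gen_ideal_step] descends from [K] to 0. *)
Lemma series_noetherian : noetherian L.
Proof.
move=> I idI; have [I0 ID IM] := idI.
case: (EM (exists d K f, I (P ^+ K * f) /\ wdeg f d))
    => [/ex_least[d [[K [f [If wf]]] min]]|nex]; last first.
  exists 0%N, (fun _ => 0); split=> [[]//|x Ix]; exists (fun _ => 0); rewrite big_ord0.
  apply: contrapT => /eqP/pi_factor[k [y [xE /wdeg_exists[d wd]]]]; apply: nex.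
  by exists d, k, y; rewrite -xE.
have fgK : fin_gen_ideal (fun g => I (P ^+ K * g)).
  exists 1%N, (fun _ => f); split=> // g Ig.
  (* Each division by [f] modulo pi moves the error to (I : pi^(k+1)), where [f] is still of least
     degree. The bound 0 on the degree makes the remainder vanish. *)
  have [g0 [k [Kk Ig0]]||q [r [gE r0]]] :=
      @pi_adic_division f 0 (fun g => exists k, (K <= k)%N /\ I (P ^+ k * g)) _ g.
  - have [e we|h [g' g0E]] := @wdeg_dvd_mod f g0 d wf.
      by apply: min; exists k, g0.
    exists h, 0, g'; rewrite addr0; split=> //; last by move=> n _; rewrite coef0.
    exists k.+1; split; first by lia.
    have -> : P ^+ k.+1 * g' = P ^+ k * g0 - (P ^+ (k - K) * h) * (P ^+ K * f).
      have -> : P ^+ k.+1 = P ^+ k * P by rewrite exprSr.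
      by rewrite -[in P ^+ k](subnK Kk) exprD g0E; ring.
    by apply: is_idealB => //; apply: IM.
  - by exists K.
  - exists (fun _ => q); rewrite big_ord1 gE.
    have -> : r = 0 by apply: coef_inj => n; rewrite r0 // coef0.
    by rewrite addr0.
elim: K fgK {If min f wf} => [|K IH] fgK.
  by move: fgK; congr fin_gen_ideal; apply: funext => g; rewrite expr0 mul1r.
apply: IH; apply: fin_gen_ideal_step; first exact: is_ideal_quot.
move: fgK; congr fin_gen_ideal; apply: funext => g.
by rewrite exprSr mulrA.
Qed.

Lemma series_finite_quotient m n : finite_residue_field pi ->
  exists s : seq L, forall c, exists r a b,
    r \in s /\ c = r + P ^+ m * a + psT ^+ n * b.
Proof.
move=> [s sE].
have swap x y : (exists s : seq L, forall c, exists r a b, r \in s /\ c = r + x * a + y * b) ->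
    exists s : seq L, forall c, exists r a b, r \in s /\ c = r + y * a + x * b.
  move=> [s0 s0E]; exists s0 => c; have [r [a [b [rs ->]]]] := s0E c.
  by exists r, b, a; rewrite addrAC.
(* Both exponents are reduced to 1; the quotient by (pi, T) is the residue field. *)
apply/swap/finite_quotient_exp/swap/finite_quotient_exp.
exists (map psC s) => c; have [y [ys [z zE]]] := sE (coef c 0%N).
have [l [h [cE _ l0 hE]]] := low_high_split 1 c; rewrite expr1 in cE.
exists (psC y), (psC z), h; split; first exact: map_f.
rewrite {1}cE; congr (_ + _); apply: coef_inj => n0; rewrite coefD coef_psCM !coef_series.
case: n0 => [|n0].
  by rewrite l0 // mulrC -zE addrC subrK.
rewrite mulr0 addr0.
have := coefD l (psT * h) n0.+1; rewrite -cE coef_psTM hE addn1.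
by move=> /eqP; rewrite -subr_eq0 opprD addrCA subrr addr0 oppr_eq0 => /eqP.
Qed.

(** * The two Euclidean localizations *)

Definition pi_inverted x := exists (y : L) k, x * y = P ^+ k.
Definition pi_inverted_degree b d := exists k b', b = P ^+ k * b' /\ wdeg b' d.

(** The divisors of powers of pi are the elements that become units. The degree is the Weierstrass
    degree after powers of pi are removed, and division is Weierstrass division. *)
Lemma euclidean_pi_inverted : euclidean_up_to pi_inverted pi_inverted_degree.
Proof.
split.
- exact: series_domain.
- by exists 1, 0%N; rewrite mulr1 expr0.
- by move=> [y [k]]; rewrite mul0r => e; have := pi_neq0 k; rewrite -e eqxx.
- move=> x y [x' [k xE]] [y' [k' yE]]; exists (x' * y'), (k + k')%N.
  by rewrite exprD -xE -yE; ring.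
- by move=> x y [z [k e]]; exists (y * z), k; rewrite mulrA.
- move=> b /pi_factor[k [y [bE /wdeg_exists[d wd]]]].
  by exists d, k, y.
- move=> a b d nb [k [b' [bE wb]]].
  have [q [r [aE r0]]] := weierstrass_division wb a.
  exists (P ^+ k), q; split; first by exists 1, k; rewrite mulr1.
  have e : P ^+ k * a - q * b = P ^+ k * r by rewrite bE aE; ring.
  case: (eqVneq r 0) => [r00|nr]; [left|right].
    by apply/eqP; rewrite -subr_eq0 e r00 mulr0.
  rewrite e; split.
    by apply/eqP => /series_domain[] /eqP; rewrite ?(negbTE (pi_neq0 k)) ?(negbTE nr).
  have [j [r' [rE /wdeg_exists[d' wr]]]] := pi_factor nr.
  exists d'; split; last by exists (k + j)%N, r'; rewrite exprD -mulrA -rE.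
  (* The remainder has no coefficient from [d] on, while its reduced part has a unit coefficient in
     degree [d']. *)
  rewrite ltnNge; apply/negP => /r0; rewrite rE coef_psCXM.
  have [npi _] := unif; move/eqP; rewrite mulf_eq0 (negbTE (expf_neq0 _ npi)) /= => /eqP r'0.
  by have [_] := wr; rewrite r'0 unitr0.
Qed.

Definition pi_ndvd_degree b d := exists b', b = P ^+ d * b' /\ ~ pi_dvd b'.

(** The localization is a discrete valuation ring with the pi-adic valuation as degree: either [b]
    divides [a] after multiplication by the unit [b'], or [a] is its own remainder. *)
Lemma euclidean_pi_local : euclidean_up_to (fun x => ~ pi_dvd x) pi_ndvd_degree.
Proof.
split.
- exact: series_domain.
- exact: pi_ndvd1.
- by apply; exists 0; rewrite mulr0.
- by have [_ _ pr] := pi_dvd_prime; move=> x y nx ny /pr[].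
- by move=> x y nxy [z zE]; apply: nxy; exists (z * y); rewrite zE mulrA.
- by move=> b /pi_factor[k [y H]]; exists k, y.
- move=> a b d nb [b' [bE nb']].
  case: (eqVneq a 0) => [->|na].
    exists 1, 0; split; first exact: pi_ndvd1.
    by left; rewrite mulr0 mul0r.
  have [j [a' [aE na']]] := pi_factor na.
  case: (ltnP j d) => [jd|dj].
    exists 1, 0; rewrite mul1r mul0r subr0; split; first exact: pi_ndvd1.
    by right; split=> //; exists j; split=> //; exists a'.
  exists b', (P ^+ (j - d) * a'); split=> //; left.
  by rewrite bE aE -{1}(subnK dj) exprD; ring.
Qed.

(** * Prime ideals and ideals of height two *)

Lemma prime_with_pi_has_T Q g : is_prime_ideal Q -> Q P -> Q g -> ~ pi_dvd g -> Q psT.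
Proof.
move=> prQ QP Qg /wdeg_exists[d /wdeg_split[u [v [w [gE uw]]]]].
have [idQ _ _] := prQ; have [_ _ QM] := idQ.
apply: (is_prime_idealX (n := d) prQ).
have -> : psT ^+ d = w * (g - v * P).
  transitivity (psT ^+ d * (u * w)); first by rewrite uw mulr1.
  by rewrite gE; ring.
by apply: (QM w); apply: (is_idealB idQ Qg); apply: (QM v).
Qed.

(* [Lambda[1/pi]] is principal, so a nonzero prime not containing [pi] is maximal there. *)
Lemma prime_above_nonzero_prime Q1 Q2 : is_prime_ideal Q1 -> is_prime_ideal Q2 ->
  (forall x, Q1 x -> Q2 x) -> (exists x, Q2 x /\ ~ Q1 x) -> (exists x, Q1 x /\ x != 0) ->
  Q2 P /\ Q2 psT.
Proof.
move=> pr1 pr2 sub [g [Q2g nQ1g]] nz.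
have [id1 n1 pr1M] := pr1; have [id2 n2 pr2M] := pr2.
have [_ QD1 QM1] := id1; have [_ QD2 QM2] := id2.
case: (EM (Q1 P)) => [Q1P|nQ1P].
  have Q2P := sub _ Q1P; split=> //; apply: (prime_with_pi_has_T pr2 Q2P Q2g).
  by move=> [y gE]; apply: nQ1g; rewrite gE mulrC; apply: QM1.
have nQ1S s : pi_inverted s -> ~ Q1 s.
  move=> [y [k e]] Q1s; apply/nQ1P/(is_prime_idealX (n := k) pr1).
  by rewrite -e mulrC; apply: QM1.
have euc := euclidean_pi_inverted.
have [f [_ [Q1f nf _ _ fdiv]]] := euc_principal euc id1 nz.
pose J y := exists u v, y = u * f + v * g.
have idJ : is_ideal J by apply: ideal2_is_ideal.
have Jf : J f by exists 1, 0; ring.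
have Jg : J g by exists 0, 1; ring.
have [|h [_ [[u [v hE]] nh _ _ hdiv]]] := euc_principal euc idJ; first by exists f.
have Q2h : Q2 h by rewrite hE; apply: QD2; apply: QM2 => //; apply: sub.
(* Over the localization [h] is a gcd of [f] and [g], with f = q h. If [q] is in [Q1], then [f]
   divides it and [h] divides a power of pi, so that [Q2] contains this power. If [h] is in [Q1],
   then so is [g], which is excluded. *)
have Q2P : Q2 P.
  have [s [q [Ss e]]] := hdiv f Jf.
  have : Q1 (q * h) by rewrite -e; apply: QM1.
  case/pr1M => [Q1q|Q1h].
    have [s' [w [Ss' e']]] := fdiv q Q1q.
    have e2 : s' * s = w * h.
      apply: (series_cancel nf); transitivity (s' * (s * f)); first by ring.
      by rewrite e; transitivity ((s' * q) * h); [ring|rewrite e'; ring].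
    have [y [k yE]] := euc_SM euc Ss' Ss.
    by apply: (is_prime_idealX (n := k) pr2); rewrite -yE e2 mulrAC; apply: QM2.
  have [s' [q' [Ss' e']]] := hdiv g Jg.
  have : Q1 (s' * g) by rewrite e'; apply: QM1.
  by case/pr1M => // Q1s; case: (nQ1S s').
split=> //.
(* As pi is not in [Q1], removing its powers from [f] leaves an element of [Q1] prime to pi. *)
have [k [f' [fE nf']]] := pi_factor nf.
apply: (prime_with_pi_has_T pr2 Q2P _ nf'); apply: sub.
by move: Q1f; rewrite fE => /pr1M[/(is_prime_idealX pr1)|].
Qed.

Lemma prime_chain2_has_pi_T Q : is_prime_ideal Q -> prime_chain_to Q 2 -> Q P /\ Q psT.
Proof.
move=> prQ [C [prC incC CQ]].
have [sub12 ex12] := incC 1%N isT; have [_ [x [C1x nC0x]]] := incC 0%N isT.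
have [C2P C2T] : C 2%N P /\ C 2%N psT.
  apply: prime_above_nonzero_prime (prC 1%N isT) (prC 2%N isT) sub12 ex12 _.
  exists x; split=> //; apply/eqP => x0; apply: nC0x; rewrite x0.
  by have [[]] := prC 0%N isT.
by split; apply/CQ.
Qed.

(** Otherwise [a] lies in a prime without powers of pi, but a prime above [a] ends a chain of length
    2 and contains pi. For [a] = 0 this prime is the zero ideal. *)
Lemma height_two_meets_pi_inverted a :
  is_ideal a -> height_two a -> exists s, a s /\ pi_inverted s.
Proof.
move=> ida [ht _]; apply: contrapT => nex.
have avoid x : a x -> ~ pi_inverted x by move=> ax Sx; apply: nex; exists x.
case: (EM (exists x, a x /\ x != 0)) => [nz|zero].
  have [Q [prQ aQ QS]] := euc_prime_avoiding euclidean_pi_inverted ida nz avoid.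
  have [QP _] := prime_chain2_has_pi_T prQ (ht Q prQ aQ).
  by apply: (QS P) => //; exists 1, 1%N; rewrite mulr1.
have pr0 := zero_ideal_prime series_domain.
have [|P0 _] := prime_chain2_has_pi_T pr0 (ht _ pr0 _).
  by move=> x ax; apply: contrapT => /eqP nx; apply: zero; exists x.
by have := pi_neq0 1; rewrite expr1 P0 eqxx.
Qed.

(** Otherwise [a] is contained in the prime (pi), which would end a chain of length 2 and contain
    T. *)
Lemma height_two_meets_pi_local a :
  is_ideal a -> height_two a -> exists s, a s /\ ~ pi_dvd s.
Proof.
move=> ida [ht _]; apply: contrapT => nex.
have [|_ /pi_ndvdT//] := prime_chain2_has_pi_T pi_dvd_prime (ht _ pi_dvd_prime _).
by move=> x ax; apply: contrapT => nx; apply: nex; exists x.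
Qed.

Lemma one_sub_pi_unit c : exists y, (1 - P * c) * y = 1.
Proof.
apply: series_unit; rewrite coefB coef_psCM coef1; apply: (uniformizer_unit unif).
move=> [d dE]; apply: (uniformizer_ndvd_unit unif (unitr1 O)).
by exists (d + coef c 0%N); rewrite mulrDl -dE [coef c _ * pi]mulrC subrK.
Qed.

Lemma one_sub_T_unit c : exists y, (1 - psT * c) * y = 1.
Proof. by apply: series_unit; rewrite coefB coef_psTM coef1 subr0 unitr1. Qed.

Lemma max_ideal_prime : is_prime_ideal (fun x => rdivides pi (coef x 0%N)).
Proof.
have coefM0 x y : coef (x * y) 0%N = coef x 0%N * coef y 0%N.
  by rewrite coefM big_ord1 subn0.
split; last by move=> x y; rewrite coefM0 => /(uniformizer_prime unif).
  split.
  - by rewrite coef0; exists 0; rewrite mul0r.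
  - by move=> x y [c xE] [d yE]; exists (c + d); rewrite coefD xE yE mulrDl.
  - by move=> r x [c xE]; exists (coef r 0%N * c); rewrite coefM0 xE mulrA.
rewrite coef1; exact: (uniformizer_ndvd_unit unif (unitr1 O)).
Qed.

Lemma mem_max_ideal x : rdivides pi (coef x 0%N) -> exists a b, x = a * P + b * psT.
Proof.
move=> [c cE]; have [l [h [xE _ l0 hE]]] := low_high_split 1 x; rewrite expr1 in xE.
exists (psC c), h; rewrite {1}xE [h * _]mulrC; congr (_ + _).
apply: coef_inj => n; rewrite coef_psCM coef_series; case: n => [|n]; first by rewrite l0.
rewrite mulr0; have := coefD l (psT * h) n.+1; rewrite -xE coef_psTM hE addn1.
by move=> /eqP; rewrite -subr_eq0 opprD addrCA subrr addr0 oppr_eq0 => /eqP.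
Qed.

Definition param_ideal t x := exists u v, x = u * P ^+ t + v * psT ^+ t.

(** Every prime above it contains pi and T, hence ends the chain 0, (pi), Q. In a chain of length 3
    ending at the maximal ideal (pi, T), the third prime would already contain both generators.
    These ideals witness [ideal_sim]. *)
Lemma height_two_param_ideal t : (0 < t)%N -> height_two (param_ideal t).
Proof.
move=> t0; split.
  move=> Q prQ aQ; have [idQ Q1 QM] := prQ; have [Q0 QD QMl] := idQ.
  have QP : Q P by apply: (is_prime_idealX (n := t) prQ); apply: aQ; exists 1, 0; ring.
  have QT : Q psT by apply: (is_prime_idealX (n := t) prQ); apply: aQ; exists 0, 1; ring.
  exists (fun j => match j with 0%N => fun x => x = 0 | 1%N => pi_dvd | _ => Q end); split.
  - case=> [|[|j]] // _; last exact: pi_dvd_prime.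
    exact: zero_ideal_prime series_domain.
  - case=> [|[|//]] _; split.
    + by move=> x ->; exists 0; rewrite mulr0.
    + exists P; split; first by exists 1; rewrite mulr1.
      by apply/eqP; have := pi_neq0 1; rewrite expr1.
    + by move=> x [y ->]; rewrite mulrC; apply: QMl.
    + by exists psT; split=> //; apply: pi_ndvdT.
  - by [].
have prm := max_ideal_prime.
have [idm _ _] := prm; have [_ mD mM] := idm.
have mP : rdivides pi (coef P 0%N) by rewrite coef_series; exists 1; rewrite mul1r.
have mT : rdivides pi (coef psT 0%N) by rewrite coef_series; exists 0; rewrite mul0r.
exists (fun x => rdivides pi (coef x 0%N)); split=> //.
  by move=> x [u [v ->]]; case: t t0 => // t _; rewrite !exprSr !mulrA; apply: mD; apply: mM.
move=> [C [prC incC Cm]].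
have [sub12 ex12] := incC 1%N isT; have [_ [x [C1x nC0x]]] := incC 0%N isT.
have [C2P C2T] : C 2%N P /\ C 2%N psT.
  apply: prime_above_nonzero_prime (prC 1%N isT) (prC 2%N isT) sub12 ex12 _.
  exists x; split=> //; apply/eqP => x0; apply: nC0x; rewrite x0.
  by have [[]] := prC 0%N isT.
have [_ [y [C3y nC2y]]] := incC 2%N isT.
apply: nC2y; have [a [b ->]] := mem_max_ideal ((Cm y).1 C3y).
have [[_ CD CM] _ _] := prC 2%N isT.
by apply: CD; apply: CM.
Qed.

(* [t] is a unit times a power of [psT] modulo [pi]. *)
Lemma psT_power_mem e t : ~ pi_dvd t ->
  exists E a b, psT ^+ E = a * P ^+ e + b * t.
Proof.
move=> /wdeg_exists[d /wdeg_split[u [v [w [tE uw]]]]].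
exists (d * e)%N; elim: e => [|e [a [b IH]]].
  by exists 1, 0; rewrite muln0 !expr0; ring.
rewrite mulnS exprD IH.
have -> : psT ^+ d = w * t - w * v * P.
  transitivity (psT ^+ d * (u * w)); first by rewrite uw mulr1.
  by rewrite tE; ring.
exists (- a * w * v), (a * P ^+ e * w + b * (w * t - w * v * P)).
by rewrite exprS; ring.
Qed.

End PowerSeries.

(** * Pseudo-isomorphisms *)

Section FiniteModules.
Variable R : comNzRingType.
Implicit Types M N : lmodType R.

Lemma finite_lincombs M n (g : 'I_n -> M) (s : seq R) : exists l : seq M,
  forall c : 'I_n -> R, (forall i, c i \in s) -> \sum_i c i *: g i \in l.
Proof.
elim: n g => [|n IH] g; first by exists [:: 0] => c _; rewrite big_ord0 inE.
have [l lE] := IH (fun i => g (lift ord0 i)).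
exists [seq a *: g ord0 + y | a <- s, y <- l] => c cs.
rewrite big_ord_recl; apply: (allpairs_f (fun a y => a *: g ord0 + y)) => //.
exact: (lE (fun i => c (lift ord0 i))).
Qed.

(** The kernel is finitely generated by noetherianity, and it is a module over the finite ring R/(a,
    b). *)
Lemma linear_kernel_finite M N (f : {linear M -> N}) a b : noetherian R -> fin_gen M ->
  (exists s : seq R, forall c, exists r u v, r \in s /\ c = r + a * u + b * v) ->
  (forall x, f x = 0 -> a *: x = 0) -> (forall x, f x = 0 -> b *: x = 0) ->
  exists l : seq M, forall x, f x = 0 -> x \in l.
Proof.
move=> noe [n [g gen]] [s sE] ka kb.
have [||k [A AE]] := @submodule_fin_gen R n (fun c => f (lincomb g c) = 0) noe.
- by rewrite lincomb0 linear0.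
- by move=> t u v u0 v0; rewrite lincombP linearP /= u0 v0 scaler0 addr0.
have [l lE] := finite_lincombs (fun i => lincomb g (row i A)) s.
exists l => x fx0.
have [c xE] : exists c, x = lincomb g c.
  have [c ->] := gen x; exists (\row_i c i).
  by apply: eq_bigr => i _; rewrite mxE.
have [d cE] : exists d, c = d *m A by apply/AE; rewrite -xE.
have [r rE] := choice (fun i => sE (d 0 i)).
have -> : x = \sum_i r i *: lincomb g (row i A).
  rewrite xE cE lincomb_mul; apply: eq_bigr => i _.
  have [u [v [_ ->]]] := rE i; rewrite !scalerDl -addrA.
  have f0 : f (lincomb g (row i A)) = 0.
    by apply/AE; exists (delta_mx 0 i); rewrite rowE.
  by rewrite ![_ * u]mulrC ![_ * v]mulrC -!scalerA ka // kb // !scaler0 !addr0.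
by apply: lE => i; have [u [v []]] := rE i.
Qed.

Lemma linear_cokernel_finite M N (f : {linear M -> N}) a b : fin_gen N ->
  (exists s : seq R, forall c, exists r u v, r \in s /\ c = r + a * u + b * v) ->
  (forall y, exists x, a *: y = f x) -> (forall y, exists x, b *: y = f x) ->
  exists l : seq N, forall y, exists z x, z \in l /\ y = z + f x.
Proof.
move=> [n [g gen]] [s sE] ka kb.
have [l lE] := finite_lincombs g s.
exists l => y; have [c ->] := gen y.
have [r rE] := choice (fun i => sE (c i)).
have /choice[h hE] i : exists x, c i *: g i = r i *: g i + f x.
  have [u [v [_ ->]]] := rE i; have [x xE] := ka (u *: g i); have [z zE] := kb (v *: g i).
  by exists (x + z); rewrite linearD /= -xE -zE !scalerDl !scalerA addrA.
exists (\sum_i r i *: g i), (\sum_i h i); split.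
  by apply: lE => i; have [u [v []]] := rE i.
by rewrite linear_sum -big_split /=; apply: eq_bigr => i _; rewrite hE.
Qed.

Lemma fin_gen_torsion_killed M : (forall x y : R, x * y = 0 -> x = 0 \/ y = 0) ->
  fin_gen M -> torsion_mod M -> exists D : R, D != 0 /\ forall x : M, D *: x = 0.
Proof.
move=> dom [n [g gen]] tor.
have [r rE] := choice (fun i => tor (g i)).
exists (\prod_i r i); split.
  apply: (big_ind (fun x : R => x != 0)); first exact: oner_neq0.
    by move=> x y nx ny; apply/eqP => /dom[] /eqP; rewrite ?(negbTE nx) ?(negbTE ny).
  by move=> i _; case: (rE i).
move=> x; have [c ->] := gen x; rewrite scaler_sumr big1 // => i _.
rewrite (bigD1 i) //= scalerA mulrC mulrCA mulrC -scalerA.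
by case: (rE i) => _ ->; rewrite scaler0.
Qed.

(** Pigeonhole: two of the elements b^k y with k at most [size s] agree modulo [Z], and their
    difference is b^i times a unit times y. Used with [Z] zero for kernels and with [Z] an image for
    cokernels. *)
Lemma topologically_nilpotent_power M (Z : M -> Prop) (b : R) (s : seq M) y :
  (forall c, exists u, (1 - b * c) * u = 1) ->
  (forall u v, Z u -> Z v -> Z (u + v)) -> (forall r u, Z u -> Z (r *: u)) ->
  (forall k, exists z, z \in s /\ Z (b ^+ k *: y - z)) -> Z (b ^+ size s *: y).
Proof.
move=> unit1 ZD ZZ /choice[z zE].
have : ~~ uniq (map z (iota 0 (size s).+1)).
  apply/negP => un; have : (size (map z (iota 0 (size s).+1)) <= size s)%N.
    by apply: uniq_leq_size un _ => _ /mapP[k _ ->]; case: (zE k).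
  by rewrite size_map size_iota ltnn.
case/(uniqPn 0) => i [j [ij]]; rewrite size_map size_iota => js.
rewrite !(nth_map 0%N) ?size_iota; [|by lia..].
rewrite !nth_iota; [|by lia..].
rewrite !add0n => zij.
have [_ Zi] := zE i; have [_ Zj] := zE j.
have Zd : Z ((b ^+ i * (1 - b * b ^+ (j - i.+1))) *: y).
  have -> : b ^+ i * (1 - b * b ^+ (j - i.+1)) = b ^+ i - b ^+ j.
    have -> : b ^+ j = b ^+ i * (b * b ^+ (j - i.+1)).
      by rewrite -exprS -exprD; congr (_ ^+ _); lia.
    by ring.
  have -> : (b ^+ i - b ^+ j) *: y = (b ^+ i *: y - z i) + (-1) *: (b ^+ j *: y - z j).
    by rewrite scaleN1r opprB zij addrA subrK scalerBl.
  by apply: ZD => //; apply: ZZ.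
have [u uE] := unit1 (b ^+ (j - i.+1)).
have -> : b ^+ size s = (b ^+ (size s - i) * u) * (b ^+ i * (1 - b * b ^+ (j - i.+1))).
  have -> : size s = ((size s - i) + i)%N by lia.
  rewrite exprD addnK; transitivity (b ^+ (size s - i) * b ^+ i * ((1 - b * b ^+ (j - i.+1)) * u)).
    by rewrite uE mulr1.
  by ring.
by rewrite -scalerA; apply: ZZ.
Qed.

Lemma linear_comb2 M N (f1 f2 : {linear M -> N}) a b :
  exists f : {linear M -> N}, forall x, f x = a *: f1 x + b *: f2 x.
Proof.
pose f x := a *: f1 x + b *: f2 x.
have lin : linear f.
  move=> c x y; rewrite /f (linearP f1) (linearP f2) /= !scalerDr !scalerA ![_ * c]mulrC -!addrA.
  by congr (_ + _); rewrite addrCA.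
pose fl : {linear M -> N} := HB.pack f (GRing.isLinear.Build R M N _ f lin).
by exists fl.
Qed.

Hypothesis noe : noetherian R.

Lemma fin_gen_presentable M : fin_gen M -> exists n k g A, @is_presentation R M n k g A.
Proof.
move=> fgM; have [n /(_ n (leqnn _))[g [k /(_ k (leqnn _))[A pA]]]] := fin_gen_presentation noe fgM.
by exists n, k, g, A.
Qed.

Lemma fitting_ideal_is_ideal M i : fin_gen M -> is_ideal (fitting_ideal M i).
Proof.
move=> /fin_gen_presentable[n [k [g [A pA]]]].
have [I0 ID IM] := minor_ideal_is_ideal A (n - i).
split; first exact/(fitting_idealE _ _ pA).
  move=> x y /(fitting_idealE _ _ pA) Ix /(fitting_idealE _ _ pA) Iy.
  exact/(fitting_idealE _ _ pA)/ID.
by move=> r x /(fitting_idealE _ _ pA) Ix; apply/(fitting_idealE _ _ pA)/IM.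
Qed.

(** [f] and the reverse map of [isogeny_inverse] have cokernels killed by powers of [b]. The bound
    [t0] is uniform, so one exponent can later serve both pi and T. *)
Lemma pseudo_isomorphism_fitting M N (f : {linear M -> N}) b :
  fin_gen M -> fin_gen N -> pseudo_isomorphism f ->
  (forall c, exists u, (1 - b * c) * u = 1) ->
  exists t0, forall t, (t0 <= t)%N -> forall i x,
    (fitting_ideal M i x -> fitting_ideal N i (b ^+ t * x)) /\
    (fitting_ideal N i x -> fitting_ideal M i (b ^+ t * x)).
Proof.
move=> fgM fgN [[s kers] [s' cokers]] unit1.
pose e := (size s + size s')%N.
have ker x : f x = 0 -> b ^+ e *: x = 0.
  move=> fx0; rewrite /e addnC exprD -scalerA.
  rewrite (topologically_nilpotent_power (Z := fun u => u = 0) unit1) ?scaler0 //.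
  - by move=> ? ? -> ->; rewrite addr0.
  - by move=> ? ? ->; rewrite scaler0.
  - move=> k; exists (b ^+ k *: x); rewrite subrr; split=> //.
    by apply: kers; rewrite linearZ /= fx0 scaler0.
have coker y : exists x, b ^+ e *: y = f x.
  have [x xE] : exists x, b ^+ size s' *: y = f x.
    apply: (topologically_nilpotent_power (Z := fun u => exists x, u = f x) unit1).
    - by move=> _ _ [u ->] [v ->]; exists (u + v); rewrite linearD.
    - by move=> r _ [u ->]; exists (r *: u); rewrite linearZ.
    - move=> k; have [z [x [zs e1]]] := cokers (b ^+ k *: y).
      by exists z; split=> //; exists x; rewrite e1 addrC addKr.
  by exists (b ^+ size s *: x); rewrite /e exprD -scalerA xE linearZ.
have [h hE] := isogeny_inverse coker ker.
have [pM pN] := (fin_gen_presentable fgM, fin_gen_presentable fgN).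
have [m mE] := fitting_ideal_map pM pN coker.
have [m' mE'] : exists m', forall i x,
    fitting_ideal N i x -> fitting_ideal M i ((b ^+ e ^+ 2) ^+ m' * x).
  by apply: (fitting_ideal_map (f := h) pN pM) => x; exists (f x); rewrite hE.
have idM i : is_ideal (fitting_ideal M i) := fitting_ideal_is_ideal i fgM.
have idN i : is_ideal (fitting_ideal N i) := fitting_ideal_is_ideal i fgN.
exists (e * m + e * 2 * m')%N => t le i x; split=> [/mE|/mE'].
  rewrite -exprM => Fx; have -> : t = ((t - e * m) + e * m)%N by lia.
  by rewrite exprD -mulrA; case: (idN i) => _ _; apply.
rewrite -!exprM mulnA => Fx; have -> : t = ((t - e * 2 * m') + e * 2 * m')%N by lia.
by rewrite exprD -mulrA; case: (idM i) => _ _; apply.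
Qed.

(** As [D] kills the module, the scalar matrix [D] factors through [A], and its determinant D^n is
    in the ideal of n-minors. *)
Lemma presentation_minor_neq0 M n k (g : 'I_n -> M) (A : 'M[R]_(k, n)) D :
  (forall x y : R, x * y = 0 -> x = 0 \/ y = 0) ->
  is_presentation g A -> D != 0 -> (forall x : M, D *: x = 0) ->
  exists x, x != 0 /\ minor_ideal A n x.
Proof.
move=> dom pA nD kD; exists (D ^+ n); split.
  elim: n {g A pA} => [|n IH]; first by rewrite expr0 oner_neq0.
  by rewrite exprS; apply/eqP => /dom[] /eqP; rewrite ?(negbTE nD) ?(negbTE IH).
have [_ relA] := (presentationP g A).1 pA.
have [C CE] : exists C, D%:M = C *m A.
  by apply: rows_mul => a; apply/relA; rewrite rowE mul_mx_scalar lincombZ kD.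
apply: (@minor_ideal_mull _ _ _ _ C); rewrite -CE.
by have := minor_ideal_mxsub (D%:M : 'M[R]_n) id id; rewrite mxsub_id det_scalar.
Qed.

(** For presentations of one common size, the ideal of r-minors is the Fitting ideal of index n - r
    for both modules, and an element of [S] in the height-two ideal supplies the factor that
    [mequiv_of_minors] asks for. *)
Lemma fitting_sim_isogeny S W M N : euclidean_up_to S W ->
  (forall a : R -> Prop, is_ideal a -> height_two a -> exists s, a s /\ S s) ->
  fin_gen M -> torsion_mod M -> fin_gen N -> torsion_mod N ->
  (forall i, ideal_sim (fitting_ideal M i) (fitting_ideal N i)) ->
  exists (f : {linear M -> N}) (h : {linear N -> M}) s,
    [/\ S s, forall x, h (f x) = s *: x & forall y, f (h y) = s *: y].
Proof.
move=> euc meet fgM torM fgN torN sim.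
have dom := euc_domain euc.
have [n1 presM] := fin_gen_presentation noe fgM.
have [n2 presN] := fin_gen_presentation noe fgN.
pose n := maxn n1 n2.
have [g [k1 {}presM]] := presM n (leq_maxl _ _).
have [g' [k2 {}presN]] := presN n (leq_maxr _ _).
pose k := maxn n (maxn k1 k2).
have [|A pA] := presM k; first by rewrite /k; lia.
have [|B pB] := presN k; first by rewrite /k; lia.
apply: (mequiv_isogeny euc pA pB).
have [D1 [nD1 kD1]] := fin_gen_torsion_killed dom fgM torM.
have [D2 [nD2 kD2]] := fin_gen_torsion_killed dom fgN torN.
apply: (mequiv_of_minors euc); first exact: leq_maxl.
- exact: presentation_minor_neq0 dom pA nD1 kD1.
- exact: presentation_minor_neq0 dom pB nD2 kD2.
- move=> r rn; have [[a [ida hta aI]] _] := sim (n - r)%N.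
  have [s [as_ Ss]] := meet a ida hta; exists s; split=> // x Ax.
  have e : (n - (n - r) = r)%N by lia.
  have := fitting_idealE (n - r) (s * x) pB; rewrite e => <-.
  apply: aI; apply: gen_ideal_sub; exists s, x; split=> //.
  by apply/(fitting_idealE _ _ pA); rewrite e.
- move=> r rn; have [_ [a [ida hta aI]]] := sim (n - r)%N.
  have [s [as_ Ss]] := meet a ida hta; exists s; split=> // x Bx.
  have e : (n - (n - r) = r)%N by lia.
  have := fitting_idealE (n - r) (s * x) pA; rewrite e => <-.
  apply: aI; apply: gen_ideal_sub; exists s, x; split=> //.
  by apply/(fitting_idealE _ _ pB); rewrite e.
Qed.

End FiniteModules.

Theorem theorem2p8 (O : idomainType) (L : comNzRingType) (coef : L -> nat -> O)
  (M N : lmodType L) :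
  complete_dvr_finite_residue O ->
  is_power_series_ring coef ->
  fin_gen M -> torsion_mod M -> nontrivial_mod M ->
  fin_gen N -> torsion_mod N -> nontrivial_mod N ->
  pseudo_isomorphic M N <->
  (forall i : nat, ideal_sim (fitting_ideal M i) (fitting_ideal N i)).
Proof.
move=> [pi [unif compl resid]] ps fgM torM _ fgN torN _.
have noe := series_noetherian ps unif compl.
have dom := series_domain ps.
set P := psC ps pi; set T := psT ps.
split=> [[f pf] i|sim].
  have [t1 H1] := pseudo_isomorphism_fitting noe fgM fgN pf (one_sub_pi_unit ps unif).
  have [t2 H2] := pseudo_isomorphism_fitting noe fgM fgN pf (one_sub_T_unit ps).
  (* The successor makes [t] positive, without which (pi^t, T^t) would be the unit ideal. *)
  pose t := (t1 + t2).+1.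
  have {}H1 := H1 t ltac:(by rewrite /t; lia) i; have {}H2 := H2 t ltac:(by rewrite /t; lia) i.
  have prec (I J : L -> Prop) : is_ideal J -> (forall x, I x -> J (P ^+ t * x)) ->
      (forall x, I x -> J (T ^+ t * x)) -> ideal_prec I J.
    move=> idJ IP IT; exists (param_ideal ps pi t).
    split; [exact: ideal2_is_ideal|exact: height_two_param_ideal|].
    apply: gen_ideal_min => // _ [_ [x [[u [v ->]] Ix ->]]].
    have [_ JD JM] := idJ; rewrite mulrDl -!mulrA.
    by apply: JD; apply: JM; [apply: IP|apply: IT].
  by split; apply: prec; try (exact: fitting_ideal_is_ideal);
    move=> x; [apply: (H1 x).1|apply: (H2 x).1|apply: (H1 x).2|apply: (H2 x).2].
have [f1 [h1 [s1 [[y [a s1E]] hf1 fh1]]]] :=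
  fitting_sim_isogeny noe (euclidean_pi_inverted ps unif compl)
    (height_two_meets_pi_inverted ps unif compl) fgM torM fgN torN sim.
have [f2 [h2 [s2 [s2E hf2 fh2]]]] :=
  fitting_sim_isogeny noe (euclidean_pi_local ps unif)
    (height_two_meets_pi_local ps unif compl) fgM torM fgN torN sim.
have [D1 [nD1 kD1]] := fin_gen_torsion_killed dom fgM torM.
have [D2 [nD2 kD2]] := fin_gen_torsion_killed dom fgN torN.
have [|m [D [DE nD]]] := pi_factor ps unif (x := D1 * D2).
  by apply/eqP => /dom[] /eqP; rewrite ?(negbTE nD1) ?(negbTE nD2).
rewrite -/P in s1E DE.
have kM (x : M) : (P ^+ m * D) *: x = 0 by rewrite -DE mulrC -scalerA kD1 scaler0.
have kN (x : N) : (P ^+ m * D) *: x = 0 by rewrite -DE -scalerA kD2 scaler0.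
have [f fE] := linear_comb2 f1 f2 (P ^+ m.+1) D.
(* The factor [y] turns the scalar [s1] of the composites into pi^a. *)
have [h hE] := linear_comb2 h1 h2 (P ^+ m.+1 * y) D.
pose sg := P ^+ (m + m + 2 + a) + D ^+ 2 * s2.
(* Stated for arbitrary modules and weights so that it covers both composites; the mixed terms c D
   and D c' are multiples of pi^m D. *)
have glue (M1 M2 : lmodType L) (p1 p2 p : {linear M1 -> M2}) (q1 q2 q : {linear M2 -> M1}) c c' :
    (forall x : M1, (P ^+ m * D) *: x = 0) ->
    (forall x, q1 (p1 x) = s1 *: x) -> (forall x, q2 (p2 x) = s2 *: x) ->
    c * c' = P ^+ m.+1 * P ^+ m.+1 * y ->
    (exists d, c = P ^+ m.+1 * d) -> (exists d, c' = P ^+ m.+1 * d) ->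
    (forall x, p x = c *: p1 x + D *: p2 x) -> (forall x, q x = c' *: q1 x + D *: q2 x) ->
    forall x, q (p x) = sg *: x.
  move=> kill e1 e2 cc [d cE] [d' cE'] pE qE x; rewrite pE linearD !linearZ /= !qE e1 e2.
  have zero r (z : M1) : (P ^+ m.+1 * r * D) *: z = 0.
    have -> : P ^+ m.+1 * r * D = P * r * (P ^+ m * D) by rewrite exprS; ring.
    by rewrite -scalerA kill scaler0.
  have z1 z : (c * D) *: z = 0 :> M1 by rewrite cE zero.
  have z2 z : (D * c') *: z = 0 :> M1 by rewrite mulrC cE' zero.
  rewrite !scalerDr !scalerA z1 z2 addr0 add0r -scalerDl; congr (_ *: _).
  have -> : c * (c' * s1) = c * c' * s1 by rewrite mulrA.
  by rewrite /sg cc !exprD -s1E exprS; ring.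
have hf : forall x, h (f x) = sg *: x.
  apply: (glue _ _ f1 f2 f h1 h2 h (P ^+ m.+1) (P ^+ m.+1 * y)) => //; first by rewrite mulrA.
    by exists 1; rewrite mulr1.
  by exists y.
have fh : forall x, f (h x) = sg *: x.
  apply: (glue _ _ h1 h2 h f1 f2 f (P ^+ m.+1 * y) (P ^+ m.+1)) => //; first by ring.
    by exists y.
  by exists 1; rewrite mulr1.
(* These are the surviving summands of pi^m sigma and D sigma modulo pi^m D, with sigma = [sg]. *)
pose e := (m + (m + m + 2 + a))%N; pose t := D ^+ 3 * s2.
have nt : ~ pi_dvd ps pi t.
  by have [_ _ pr] := pi_dvd_prime ps unif; move=> /pr[/(is_prime_idealX (pi_dvd_prime ps unif))|].
(* Since [t] is prime to pi, T^E lies in (pi^e, t); finiteness then follows from that of the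
   quotient by (pi^e, T^E). *)
have [E [u [v TE]]] := psT_power_mem unif e nt.
rewrite -/P -/T in TE.
have eE : P ^+ e = P ^+ m * sg - D * s2 * (P ^+ m * D) by rewrite /e /sg exprD; ring.
have tE : t = D * sg - P ^+ (m + 2 + a) * (P ^+ m * D).
  by rewrite /t /sg !exprD; ring.
have fin := series_finite_quotient ps e E resid.
have red (M1 : lmodType L) (x : M1) : (forall z : M1, (P ^+ m * D) *: z = 0) ->
    P ^+ e *: x = P ^+ m *: (sg *: x) /\ t *: x = D *: (sg *: x).
  move=> kill; rewrite eE tE !scalerBl -(scalerA (P ^+ m) sg) -(scalerA D sg).
  by rewrite -(scalerA (D * s2)) -(scalerA (P ^+ (m + 2 + a))) kill !scaler0 !subr0.
exists f; split.
  apply: (linear_kernel_finite noe fgM fin) => x fx; have [xP xt] := red M x kM.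
    by rewrite xP -hf fx linear0 scaler0.
  by rewrite TE scalerDl -(scalerA u) -(scalerA v) xP xt -hf fx linear0 !scaler0 addr0.
apply: (linear_cokernel_finite fgN fin) => x; have [xP xt] := red N x kN.
  by exists (P ^+ m *: h x); rewrite xP -fh linearZ.
exists (u *: (P ^+ m *: h x) + v *: (D *: h x)).
have fZ c z : f (c *: z) = c *: f z by apply: linearZ.
by rewrite TE scalerDl -(scalerA u) -(scalerA v) xP xt -fh linearD !fZ.
Qed.
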